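(* Let $T$ be an infinite finitely generated commutative ring. The problem of determining whether a computable power series $f(x)\in T[[x]]$ is expressible as the product of a unit in $T[[x]]$ and a polynomial in $T[x]$ is undecidable. That is, there is no algorithm (Turing machine) which takes as input a Turing machine computing the coefficients of a power series $f(x)\in T[[x]]$ and which always halts and correctly outputs whether or not there exist $p(x)\in T[x]$ and $u(x)\in T[[x]]^{\times}$ with $f(x)=p(x)u(x)$.
   Context: All rings are commutative with a nonzero identity; ''finitely generated'' means finitely generated as a ring (i.e. as a $\mathbb{Z}$-algebra). Fix generators $t_1,\ldots,t_k$ of $T$ and encode elements of $T$ by integer polynomials in $\mathbb{Z}[y_1,\ldots,y_k]$ (written in a standard way as words over a finite alphabet) via the surjection $y_i\mapsto t_i$. A power series $f(x)=\sum_{n\ge 0}a(n)x^n\in T[[x]]$ is computable if there is a Turing machine which, on every input $n\in\mathbb{N}$, halts and outputs an encoding of $a(n)$. The decision problem has as inputs such Turing machines (those computing the coefficient function of some power series in $T[[x]]$). *)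

(* Defs.v *)
From HB Require Import structures.
From mathcomp Require Import all_boot all_order all_algebra.
From mathcomp Require Import mpoly.

Set Implicit Arguments.
Unset Strict Implicit.
Unset Printing Implicit Defensive.

Import GRing.Theory.
Local Open Scope ring_scope.

Inductive move := MLeft | MStay | MRight.

(* In state [q_src] reading [s_read]: write [s_write], move the head by
   [q_move], enter state [q_dst]. *)
Record instr := Instr {
  q_src : nat; s_read : nat; s_write : nat; q_move : move; q_dst : nat }.

(* States and tape symbols are natural numbers, state 0 being initial and
   symbol 0 being the blank. A machine is the finite table of its transition
   function, so only finitely many states and symbols matter; it halts when no
   instruction applies. *)
Definition tm := seq instr.

Definition lookup (M : tm) (q s : nat) : option instr :=
  ohead [seq i <- M | (q_src i == q) && (s_read i == s)].

(* There is a single tape, infinite in both directions. *)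
Record config := Config {
  c_state : nat; c_head : int; c_tape : int -> nat }.

Definition shift (m : move) (h : int) : int :=
  match m with MLeft => h - 1 | MStay => h | MRight => h + 1 end.

Definition step (M : tm) (c : config) : option config :=
  if lookup M (c_state c) (c_tape c (c_head c)) is Some i then
    Some (Config (q_dst i) (shift (q_move i) (c_head c))
            (fun z => if z == c_head c then s_write i else c_tape c z))
  else None.

(* [run M n c] is the configuration after [n] steps, or the halting
   configuration if [M] halts earlier. *)
Fixpoint run (M : tm) (n : nat) (c : config) : config :=
  if n is n'.+1 then if step M c is Some c' then run M n' c' else c else c.

Definition word := seq bool.

Definition symbols (w : word) : seq nat := [seq if b then 2%N else 1%N | b <- w].

Definition init (w : word) : config :=
  Config 0 0 (fun z => if z is Posz i then nth 0%N (symbols w) i else 0%N).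

(* The case [i = size v] says that the word [v] is followed by a blank. *)
Definition reads (c : config) (v : word) : Prop :=
  forall i : nat, (i <= size v)%N ->
    c_tape c (c_head c + i%:Z) = nth 0%N (symbols v) i.

(* The output is the word found from the halting position of the head
   rightwards up to the first blank. *)
Definition outputs (M : tm) (w v : word) : Prop :=
  exists n : nat, step M (run M n (init w)) = None /\ reads (run M n (init w)) v.

(* [n] is written [1^n 0]; all the codes below are self-delimiting, hence
   uniquely decodable. *)
Definition code_nat (n : nat) : word := rcons (nseq n true) false.

Definition code_int (z : int) : word := (z < 0) :: code_nat `|z|%N.

Definition code_seq (A : Type) (code : A -> word) (s : seq A) : word :=
  code_nat (size s) ++ flatten [seq code x | x <- s].

Definition code_move (m : move) : word :=
  code_nat (match m with MLeft => 0 | MStay => 1 | MRight => 2 end).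

Definition code_instr (i : instr) : word :=
  code_nat (q_src i) ++ code_nat (s_read i) ++ code_nat (s_write i)
    ++ code_move (q_move i) ++ code_nat (q_dst i).

Definition code_tm (M : tm) : word := code_seq code_instr M.

Definition code_term (k : nat) (cm : int * 'X_{1..k}) : word :=
  code_int cm.1 ++ flatten [seq code_nat (cm.2 i) | i <- enum 'I_k].

(* A polynomial is written as a list of terms; neither the order of the terms
   nor the absence of repetitions is imposed. *)
Definition encodes_mpoly (k : nat) (w : word) (p : {mpoly int[k]}) : Prop :=
  exists s : seq (int * 'X_{1..k}),
    w = code_seq (@code_term k) s /\ p = \sum_(cm <- s) cm.1 *: 'X_[cm.2].

Definition eval_at (T : comNzRingType) (k : nat) (t : 'I_k -> T)
    (p : {mpoly int[k]}) : T :=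
  mmap (fun z : int => z%:~R) t p.

Definition generates (T : comNzRingType) (k : nat) (t : 'I_k -> T) : Prop :=
  forall x : T, exists p : {mpoly int[k]}, eval_at t p = x.

Definition infinite_type (T : eqType) : Prop :=
  ~ exists s : seq T, forall x : T, x \in s.

Definition encodes (T : comNzRingType) (k : nat) (t : 'I_k -> T)
    (w : word) (x : T) : Prop :=
  exists p : {mpoly int[k]}, encodes_mpoly w p /\ eval_at t p = x.

Definition series (T : comNzRingType) := nat -> T.

Definition series_one (T : comNzRingType) : series T := fun n => (n == 0%N)%:R.

Definition series_mul (T : comNzRingType) (f g : series T) : series T :=
  fun n => \sum_(i < n.+1) f i * g (n - i)%N.

Definition series_of_poly (T : comNzRingType) (p : {poly T}) : series T :=
  fun n => p`_n.

Definition series_unit (T : comNzRingType) (u : series T) : Prop :=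
  exists v : series T, series_mul u v =1 series_one T.

Definition poly_times_unit (T : comNzRingType) (f : series T) : Prop :=
  exists (p : {poly T}) (u : series T),
    series_unit u /\ f =1 series_mul (series_of_poly p) u.

Definition computes_series (T : comNzRingType) (k : nat) (t : 'I_k -> T)
    (M : tm) (f : series T) : Prop :=
  forall n : nat, exists w : word, outputs M (code_nat n) w /\ encodes t w (f n).

(* Nothing is required of [D] on words that are not codes of machines computing
   a power series. *)
Definition decides_poly_times_unit (T : comNzRingType) (k : nat)
    (t : 'I_k -> T) (D : tm) : Prop :=
  forall (M : tm) (f : series T), computes_series t M f ->
    exists b : bool, outputs D (code_tm M) [:: b] /\ (b <-> poly_times_unit f).

(* Main.v *)
(* Every polynomial is a polynomial times a unit, so it suffices to exhibit one
   computable series g that is not: given a decider D, the machine M that knows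
   its own code and outputs g(n), or 0 once D has been seen within n steps to
   answer "false" on the code of M, refutes D.

   For g take q + x + x^3 + x^13 + ..., each exponent exceeding the square of
   the previous one.  Suppose g = p u with u a unit; normalize p(0) = q.
   Let A be Z if T has characteristic 0; otherwise some generator of T is
   transcendental modulo some prime l (else T would be finite), and A is
   F_l[y].  A Groebner basis over Frac A shows that, after inverting some
   c <> 0 of A, the constant term of the normal form is an A-linear functional
   on (a quotient of) T sending 1 to 1.  Choose the prime q of A not dividing
   c.  Applying the functional to the coefficients of p gives P <> 0 in A[x]
   vanishing at the q-adic root alpha of g.  Take P of minimal degree.  If a
   truncation G of g is not killed by alpha, then the resultant of P and G is
   nonzero, but divisible by q to the power of the next exponent, which is
   too much for its size.  So alpha kills all long truncations, hence their
   differences, hence a power of x: absurd. *)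

From Stdlib Require Import FunctionalExtensionality PeanoNat Classical IndefiniteDescription.
Require Import Defs.
From mathcomp Require Import all_boot all_order all_algebra.
From mathcomp Require Import perm mpoly zify ring.

Set Implicit Arguments.
Unset Strict Implicit.
Unset Printing Implicit Defensive.

Import Order.TTheory GRing.Theory Num.Theory.

(** * Structured programs compiled to Turing machines *)

(** The self-reference uses neither a universal machine nor the recursion theorem. A table [C] that
    works for every stored constant [w] is built first, and [w] is chosen afterwards to encode [C];
    the table of [writer w], which puts [w] on the tape, is regular enough to be spelled out from
    [w] alone. The simulation of [D] is cut at [n] steps so that every coefficient is produced,
    whatever [D] does. On the algebraic side [T] may have zero divisors, and in positive
    characteristic it need not contain any field, so that [A] acts only on a quotient of [T]; a
    relation between polynomials and elements of [T] stands in for the missing ring morphism. The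
    [q]-adic completion is never formed: vanishing at alpha is a family of congruences along
    approximations. Normal forms cost uncontrolled powers of [c]; these cancel modulo powers of [q]
    exactly because [q] does not divide [c]. The gaps must beat every linear function, since the
    resultant is bounded by an exponential of a constant times the degree of the truncation, and
    that constant depends on the unknown [P]. *)

Lemma run_add M m n c : run M (m + n) c = run M n (run M m c).
Proof.
elim: m c => [|m IHm] c //=; case Ec: (step M c) => [c'|]; first exact: IHm.
by case: n {IHm} => //= n; rewrite Ec.
Qed.

Lemma runS M n c : run M n.+1 c = odflt (run M n c) (step M (run M n c)).
Proof. by rewrite -addn1 run_add /=; case: step. Qed.

Lemma run_halted M n m c :
  step M (run M n c) = None -> n <= m -> run M m c = run M n c.
Proof.
by move=> Hn /subnKC <-; rewrite run_add; elim: (m - n) => //= k; rewrite Hn.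
Qed.

Definition reach M c c' := exists n, run M n c = c'.

Lemma reach_trans M c1 c2 c3 : reach M c1 c2 -> reach M c2 c3 -> reach M c1 c3.
Proof. by move=> [m <-] [n <-]; exists (m + n); rewrite run_add. Qed.

Definition put (t : int -> nat) (h : int) (v : nat) : int -> nat :=
  fun z => if z == h then v else t z.

Lemma put_same t h : put t h (t h) = t.
Proof. by apply: functional_extensionality => z; rewrite /put; case: eqP => [->|]. Qed.

Lemma reach_step M i h t :
  lookup M (q_src i) (t h) = Some i ->
  reach M (Config (q_src i) h t)
    (Config (q_dst i) (shift (q_move i) h) (put t h (s_write i))).
Proof. by move=> Hi; exists 1; rewrite /= /step /= Hi. Qed.

Definition deterministic (M : tm) := uniq [seq (q_src i, s_read i) | i <- M].

Lemma lookup_mem M i :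
  deterministic M -> List.In i M -> lookup M (q_src i) (s_read i) = Some i.
Proof.
rewrite /deterministic /lookup; elim: M => //= j M IHM /andP[jM uM] [->|iM].
  by rewrite !eqxx.
have [/andP[/eqP Eq /eqP Es]|_] := boolP ((q_src j == q_src i) && _); last exact: IHM.
case/negP: jM; rewrite Eq Es {IHM uM Eq Es}.
by elim: M iM => //= k M IHM [->|/IHM]; rewrite inE ?eqxx // => ->; rewrite orbT.
Qed.

Lemma lookup_out M q s :
  all (fun i => q_src i != q) M -> lookup M q s = None.
Proof. by rewrite /lookup; elim: M => //= i M IHM /andP[/negPf-> /IHM]. Qed.

Inductive prog :=
  | Act of (nat -> nat) & move
  | Chain of prog & prog
  | Cond of pred nat & prog & prog
  | While of pred nat & prog.

Notation conf := (int * (int -> nat))%type.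

(** The compiled table is finite, with instructions only for symbols below [b]; hence every
    constructor that scans a cell demands [t h < b]. *)
Inductive exec (b : nat) : prog -> conf -> conf -> Prop :=
  | ExecAct f m h t : t h < b ->
      exec b (Act f m) (h, t) (shift m h, put t h (f (t h)))
  | ExecChain p q c1 c2 c3 :
      exec b p c1 c2 -> exec b q c2 c3 -> exec b (Chain p q) c1 c3
  | ExecThen (P : pred nat) p q h t c : t h < b -> P (t h) ->
      exec b p (h, t) c -> exec b (Cond P p q) (h, t) c
  | ExecElse (P : pred nat) p q h t c : t h < b -> ~~ P (t h) ->
      exec b q (h, t) c -> exec b (Cond P p q) (h, t) c
  | ExecStop (P : pred nat) p h t : t h < b -> ~~ P (t h) ->
      exec b (While P p) (h, t) (h, t)
  | ExecLoop (P : pred nat) p h t c c' : t h < b -> P (t h) ->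
      exec b p (h, t) c -> exec b (While P p) c c' ->
      exec b (While P p) (h, t) c'.

Fixpoint states (p : prog) : nat :=
  match p with
  | Act _ _ => 1
  | Chain p q => states p + states q
  | Cond _ p q => (states p + states q).+1
  | While _ p => (states p).+1
  end.

(* Only odd states are used, so that the even ones remain available for the
   part of the final machine that writes a constant on the tape. *)
Definition branch b s (P : pred nat) (s1 s2 : nat) : tm :=
  [seq Instr s.*2.+1 x x MStay (if P x then s1 else s2) | x <- iota 0 b].

(** The entry [s] is an index standing for the state [s.*2.+1], whereas the exit [e] is itself a
    state. *)
Fixpoint compile (b : nat) (p : prog) (s e : nat) : tm :=
  match p with
  | Act f m => [seq Instr s.*2.+1 x (f x) m e | x <- iota 0 b]
  | Chain p q =>
      compile b p s (s + states p).*2.+1 ++ compile b q (s + states p) e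
  | Cond P p q =>
      branch b s P s.+1.*2.+1 (s.+1 + states p).*2.+1 ++
      compile b p s.+1 e ++ compile b q (s.+1 + states p) e
  | While P p =>
      branch b s P s.+1.*2.+1 e ++ compile b p s.+1 s.*2.+1
  end.

Lemma in_map_iota (f : nat -> instr) b x :
  x < b -> List.In (f x) [seq f y | y <- iota 0 b].
Proof.
move=> lt_xb; have: x \in iota 0 b by rewrite mem_iota.
elim: (iota 0 b) => //= y s IHs; rewrite inE => /predU1P[->|/IHs]; first by left.
by right.
Qed.

Definition contains M (C : tm) :=
  forall i, List.In i C -> lookup M (q_src i) (s_read i) = Some i.

Lemma contains_cat M C1 C2 :
  contains M (C1 ++ C2) -> contains M C1 /\ contains M C2.
Proof.
by move=> MC; split=> i iC; apply: MC; apply/List.in_app_iff; [left | right].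
Qed.

Lemma reach_branch M b s P s1 s2 h t :
  contains M (branch b s P s1 s2) -> t h < b ->
  reach M (Config s.*2.+1 h t) (Config (if P (t h) then s1 else s2) h t).
Proof.
move=> MC lt_tb; have /MC := in_map_iota (fun x =>
  Instr s.*2.+1 x x MStay (if P x then s1 else s2)) lt_tb.
by move=> Hl; have := reach_step (t := t) (h := h) Hl; rewrite /= put_same.
Qed.

Lemma compile_correct b p c c' : exec b p c c' ->
  forall M s e, contains M (compile b p s e) ->
  reach M (Config s.*2.+1 c.1 c.2) (Config e c'.1 c'.2).
Proof.
elim=> {p c c'} /=.
- move=> f m h t lt_tb M s e MC.
  have /MC := in_map_iota (fun x => Instr s.*2.+1 x (f x) m e) lt_tb.
  exact: reach_step.
- move=> p q c1 c2 c3 _ IHp _ IHq M s e /contains_cat[/IHp Hp /IHq Hq].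
  exact: reach_trans Hp Hq.
- move=> P p q h t c lt_tb Pt _ IH M s e /contains_cat[Hb /contains_cat[/IH Hp _]].
  by have /= := reach_branch Hb lt_tb; rewrite Pt => /reach_trans; apply.
- move=> P p q h t c lt_tb Pt _ IH M s e /contains_cat[Hb /contains_cat[_ /IH Hp]].
  by have /= := reach_branch Hb lt_tb; rewrite (negPf Pt) => /reach_trans; apply.
- move=> P p h t lt_tb Pt M s e /contains_cat[Hb _].
  by have /= := reach_branch Hb lt_tb; rewrite (negPf Pt).
move=> P p h t c c' lt_tb Pt _ IHp _ IHw M s e MC.
have [Hb /IHp Hp] := contains_cat MC.
have /= := reach_branch Hb lt_tb; rewrite Pt => /reach_trans; apply.
exact: reach_trans Hp (IHw _ _ _ MC).
Qed.

Definition src_in (lo hi : nat) (i : instr) :=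
  odd (q_src i) && (lo <= (q_src i)./2 < hi).

Lemma src_in_sub lo hi lo' hi' C :
  lo' <= lo -> hi <= hi' -> all (src_in lo hi) C -> all (src_in lo' hi') C.
Proof.
by move=> Hlo Hhi; apply: sub_all => i; rewrite /src_in => /andP[->] /=; lia.
Qed.

Lemma src_in_map lo hi s (f : nat -> instr) r : lo <= s < hi ->
  (forall x, q_src (f x) = s.*2.+1) -> all (src_in lo hi) [seq f x | x <- r].
Proof.
move=> Hs Hf; elim: r => //= x r ->; rewrite /src_in Hf /= odd_double uphalf_double.
by rewrite Hs.
Qed.

(** This serves twice: disjoint index intervals make concatenated tables deterministic, and an exit
    state beyond the interval has no instruction, so the machine halts there. *)
Lemma compile_src b p s e : all (src_in s (s + states p)) (compile b p s e).
Proof.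
elim: p s e => [f m|p IHp q IHq|P p IHp q IHq|P p IHp] s e /=;
  rewrite ?all_cat; first by apply: src_in_map => //; lia.
- by apply/andP; split; [apply: src_in_sub (IHp _ _) | apply: src_in_sub (IHq _ _)]; lia.
- apply/and3P; split; first by apply: src_in_map => //; lia.
  + by apply: src_in_sub (IHp _ _); lia.
  + by apply: src_in_sub (IHq _ _); lia.
- apply/andP; split; first by apply: src_in_map => //; lia.
  by apply: src_in_sub (IHp _ _); lia.
Qed.

Lemma deterministic_cat (a : pred instr) C1 C2 :
  (forall i j, q_src i = q_src j -> a i = a j) ->
  deterministic C1 -> deterministic C2 -> all a C1 -> ~~ has a C2 ->
  deterministic (C1 ++ C2).
Proof.
move=> aP; rewrite /deterministic map_cat cat_uniq => -> -> /= aC1 aC2.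
rewrite andbT; apply/hasPn=> k; apply: contraTN => kC1; apply/negP => kC2.
have mem_map_ex C : k \in [seq (q_src i, s_read i) | i <- C] ->
    (all a C -> exists2 i, a i & q_src i = k.1) /\
    (~~ has a C -> exists2 i, ~~ a i & q_src i = k.1).
  elim: C => //= i C IHC; rewrite inE => /predU1P[->|/IHC[H1 H2]].
    by split=> [/andP[Ai _]|/norP[Ai _]]; exists i.
  by split=> [/andP[_ /H1]|/norP[_ /H2]].
have [/(_ aC1)[i ai Ei] _] := mem_map_ex _ kC1.
have [_ /(_ aC2)[j aj Ej]] := mem_map_ex _ kC2.
by rewrite (aP j i) ?ai // Ei in aj.
Qed.

Lemma deterministic_map s (f : nat -> instr) b :
  (forall x, q_src (f x) = s) -> (forall x, s_read (f x) = x) ->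
  deterministic [seq f x | x <- iota 0 b].
Proof.
move=> Hs Hx; rewrite /deterministic -map_comp map_inj_uniq ?iota_uniq //.
by move=> x y /=; rewrite !Hx => -[].
Qed.

Lemma src_in_disjoint lo mid hi C1 C2 :
  deterministic C1 -> deterministic C2 ->
  all (src_in lo mid) C1 -> all (src_in mid hi) C2 -> deterministic (C1 ++ C2).
Proof.
move=> D1 D2 A1 A2; apply: (deterministic_cat (a := src_in lo mid)) => //.
  by move=> i j; rewrite /src_in => ->.
rewrite -all_predC; apply: sub_all A2 => i /=; rewrite /src_in.
by move=> /andP[->] /=; lia.
Qed.

Lemma compile_deterministic b p s e : deterministic (compile b p s e).
Proof.
have Hbr s' P s1 s2 : deterministic (branch b s' P s1 s2).
  exact: (deterministic_map (s := s'.*2.+1)).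
have Hbs s' P s1 s2 : all (src_in s' s'.+1) (branch b s' P s1 s2).
  by apply: (src_in_map (s := s')) => //; lia.
elim: p s e => [f m|p IHp q IHq|P p IHp q IHq|P p IHp] s e /=.
- exact: (deterministic_map (s := s.*2.+1)).
- by apply: src_in_disjoint (compile_src _ _ _ _) (compile_src _ _ _ _).
- apply: (src_in_disjoint (mid := s.+1) (hi := s.+1 + states p + states q)) (Hbs _ _ _ _) _ => //.
    by apply: src_in_disjoint (compile_src _ _ _ _) (compile_src _ _ _ _).
  rewrite all_cat; apply/andP; split; last by apply: src_in_sub (compile_src _ _ _ _); lia.
  by apply: src_in_sub (compile_src _ _ _ _); lia.
- exact: src_in_disjoint (Hbs _ _ _ _) (compile_src _ _ _ _).
Qed.

(** * Register programs *)

Notation env := (nat -> nat).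

Definition upd (e : env) (r v : nat) : env := fun r' => if r' == r then v else e r'.

Inductive cmd :=
  | Skip
  | Inc of nat
  | Dec of nat
  | Then of cmd & cmd
  | If of nat & cmd & cmd
  | For of nat & cmd.

(* [For r c] counts [r] down to zero; the body must leave [r] alone. *)
Fixpoint sem (c : cmd) (e : env) : env :=
  match c with
  | Skip => e
  | Inc r => upd e r (e r).+1
  | Dec r => upd e r (e r).-1
  | Then c d => sem d (sem c e)
  | If r c d => if 0 < e r then sem c e else sem d e
  | For r c => iter (e r) (fun e' => sem c (upd e' r (e' r).-1)) e
  end.

Fixpoint keeps (r : nat) (c : cmd) : bool :=
  match c with
  | Skip => true
  | Inc r' | Dec r' => r' != r
  | Then c d | If _ c d => keeps r c && keeps r d
  | For r' c => (r' != r) && keeps r c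
  end.

Fixpoint wf (K : nat) (c : cmd) : bool :=
  match c with
  | Skip => true
  | Inc r | Dec r => 0 < r < K
  | Then c d => wf K c && wf K d
  | If r c d => [&& 0 < r < K, wf K c & wf K d]
  | For r c => [&& 0 < r < K, keeps r c & wf K c]
  end.

Lemma keepsP r c e : keeps r c -> sem c e r = e r.
Proof.
elim: c e => //= [r' e|r' e|c IHc d IHd e|r' c IHc d IHd e|r' c IHc e].
- by rewrite /upd eq_sym => /negPf->.
- by rewrite /upd eq_sym => /negPf->.
- by case/andP=> /IHc Hc /IHd->.
- by case/andP=> /IHc Hc /IHd Hd; case: ifP.
case/andP=> r'r /IHc Hc; elim: (e r') => //= n IHn.
by rewrite Hc /upd eq_sym (negPf r'r).
Qed.

Lemma ltn_exp2_testbit x n :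
  (forall m, n <= m -> Nat.testbit x m = false) -> x < 2 ^ n.
Proof.
move=> Hx; rewrite ltnNge; apply/negP => le_nx.
have x0 : x <> 0 by have := expn_gt0 2 n; lia.
suff le_nl: n <= Nat.log2 x by have := Hx _ le_nl; rewrite Nat.bit_log2.
have Epow: Nat.pow 2 n = 2 ^ n by elim: n {Hx le_nx} => //= n ->; rewrite expnS; lia.
have /Nat.log2_le_mono : Peano.le (Nat.pow 2 n) x by rewrite Epow; lia.
by rewrite Nat.log2_pow2; lia.
Qed.

Lemma testbit_ltn_exp2 x n m : x < 2 ^ n -> n <= m -> Nat.testbit x m = false.
Proof.
move=> lt_xn le_nm; have [->|x0] := eqVneq x 0; first by rewrite Nat.bits_0.
apply: Nat.bits_above_log2; apply/Nat.log2_lt_pow2; first by lia.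
have: 2 ^ n <= Nat.pow 2 m; last by lia.
rewrite -[m](subnKC le_nm); elim: (m - n) => [|k IHk].
  by rewrite addn0; elim: n {lt_xn le_nm} => //= n; rewrite expnS; lia.
by rewrite addnS /=; lia.
Qed.

Lemma setbit_bound x n r : r < n -> x < 2 ^ n -> Nat.setbit x r < 2 ^ n.
Proof.
move=> lt_rn lt_xn; apply: ltn_exp2_testbit => m le_nm.
rewrite Nat.setbit_eqb (testbit_ltn_exp2 lt_xn) // orbF.
by apply/Nat.eqb_neq; lia.
Qed.

Lemma clearbit_bound x n r : x < 2 ^ n -> Nat.clearbit x r < 2 ^ n.
Proof.
move=> lt_xn; apply: ltn_exp2_testbit => m le_nm.
by rewrite Nat.clearbit_eqb (testbit_ltn_exp2 lt_xn).
Qed.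

(** Bit [K] marks cell -1, where the head rests between commands; moving left from any cell to its
    right stops there. Cells further left only need to hold admissible symbols. *)
Definition framed (K : nat) (t : int -> nat) : Prop :=
  [/\ forall z, t z < 2 ^ K.+1, forall z : nat, Nat.testbit (t z) K = false
    & Nat.testbit (t (- 1)%R) K].

(** Register [r] is the track formed by bit [r], written in unary from cell 0. Bit 0 is excluded
    because the closing letter [false] of the input, symbol 1, leaves it set. *)
Definition rep (K : nat) (e : env) (t : int -> nat) : Prop :=
  framed K t /\
  forall (z r : nat), 0 < r < K -> Nat.testbit (t z) r = (z < e r).

Definition go_right := Act id MRight.
Definition go_left := Act id MLeft.
Definition scan (r : nat) := Chain go_right (While (Nat.testbit^~ r) go_right).
Definition home (K : nat) := While (fun x => ~~ Nat.testbit x K) go_left.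
Definition decr (K r : nat) :=
  Chain (scan r) (Chain go_left (Chain (Act (Nat.clearbit^~ r) MStay) (home K))).

(** Every command starts and ends with the head on cell -1. A register is positive exactly when cell
    0 carries its bit, so a test costs one move to the right. *)
Fixpoint translate (K : nat) (c : cmd) : prog :=
  match c with
  | Skip => Chain go_right go_left
  | Inc r => Chain (scan r) (Chain (Act (Nat.setbit^~ r) MStay) (home K))
  | Dec r => decr K r
  | Then c d => Chain (translate K c) (translate K d)
  | If r c d =>
      Chain go_right (Cond (Nat.testbit^~ r)
        (Chain go_left (translate K c)) (Chain go_left (translate K d)))
  | For r c =>
      Chain go_right (Chain
        (While (Nat.testbit^~ r)
          (Chain go_left (Chain (decr K r) (Chain (translate K c) go_right))))
        go_left)
  end.

Section Translation.
Variable K : nat.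
Let b := 2 ^ K.+1.

Lemma exec_right h t : t h < b -> exec b go_right (h, t) ((h + 1)%R, t).
Proof. by move=> Hh; have := ExecAct id MRight Hh; rewrite /= put_same. Qed.

Lemma exec_left h t : t h < b -> exec b go_left (h, t) ((h - 1)%R, t).
Proof. by move=> Hh; have := ExecAct id MLeft Hh; rewrite /= put_same. Qed.

Lemma exec_rightN t : framed K t -> exec b go_right ((- 1)%R, t) (0%R, t).
Proof. by case=> Hb _ _; apply: exec_right. Qed.

Lemma exec_leftN t : framed K t -> exec b go_left (0%R, t) ((- 1)%R, t).
Proof. by case=> Hb _ _; apply: exec_left. Qed.

Lemma exec_home t (z : int) : framed K t -> (- 1 <= z)%R ->
  exec b (home K) (z, t) ((- 1)%R, t).
Proof.
case=> Hb H0 H1 Hz; have {Hz} [n ->]: exists n : nat, z = ((Posz n) - 1)%R.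
  by exists (absz (z + 1)%R); lia.
elim: n => [|n IHn]; first by apply: ExecStop; rewrite /= ?H1.
apply: (@ExecLoop _ _ _ _ _ ((Posz n) - 1, t)%R) => //.
  by rewrite (_ : (_ - 1)%R = (Posz n)) ?H0 //; lia.
by have := exec_left (Hb ((Posz n.+1) - 1)%R); congr (exec _ _ _ (_, _)); lia.
Qed.

Lemma exec_scan e t r : rep K e t -> 0 < r < K ->
  exec b (scan r) ((- 1)%R, t) ((Posz (e r)), t).
Proof.
case=> Ht Hr r0; apply: ExecChain; first exact: exec_rightN.
have Hb : forall z, t z < b by case: Ht.
suff Hm n m : n + m = e r -> exec b (While (Nat.testbit^~ r) go_right) ((Posz n), t) ((Posz (e r)), t).
  exact: (Hm 0 (e r)).
elim: m n => [|m IHm] n Hn.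
  by rewrite -Hn addn0; apply: ExecStop; rewrite ?Hr //; lia.
apply: (@ExecLoop _ _ _ _ _ ((Posz n.+1), t)) => //; first by rewrite Hr //; lia.
  by have := exec_right (Hb n); congr (exec _ _ _ (_, _)); lia.
by apply: IHm; lia.
Qed.

Lemma rep_set e t r : 0 < r < K -> rep K e t ->
  rep K (upd e r (e r).+1) (put t (Posz (e r)) (Nat.setbit (t (Posz (e r))) r)).
Proof.
move=> r0 [[Hb H0 H1] Hr]; split; first split=> [z|z|].
- rewrite /put; case: eqP => // _; apply: setbit_bound => //; lia.
- rewrite /put; case: eqP => // _; rewrite Nat.setbit_eqb H0 orbF.
  by apply/Nat.eqb_neq; lia.
- by rewrite /put; case: eqP => // ?; lia.
move=> z s s0; rewrite /put /upd.
have [/eqP|ne_z] := eqVneq (Posz z) (Posz (e r)).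
  rewrite eqz_nat => /eqP->; rewrite Nat.setbit_eqb Hr //.
  by have [->|] := eqVneq s r; [rewrite Nat.eqb_refl; lia | case: Nat.eqb_spec; lia].
by rewrite Hr //; have [->|//] := eqVneq s r; lia.
Qed.

(** For [e r = 0] the cleared cell is the home cell -1, whose bit [r] has no meaning; this agrees
    with the truncated predecessor. *)
Lemma rep_clear e t r : 0 < r < K -> rep K e t ->
  let h := ((Posz (e r)) - 1)%R in
  rep K (upd e r (e r).-1) (put t h (Nat.clearbit (t h) r)).
Proof.
move=> r0 [[Hb H0 H1] Hr] h; split; first split=> [z|z|].
- by rewrite /put; case: eqP => // _; apply: clearbit_bound.
- by rewrite /put; case: eqP => // <-; rewrite Nat.clearbit_eqb H0.
- rewrite /put; case: eqP => // <-; rewrite Nat.clearbit_eqb H1 /=.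
  by case: Nat.eqb_spec; lia.
move=> z s s0; rewrite /put /upd.
have [Ez|ne_z] := eqVneq (Posz z) h.
  rewrite -Ez Nat.clearbit_eqb Hr //.
  by have [->|] := eqVneq s r; [rewrite Nat.eqb_refl; lia | case: Nat.eqb_spec; lia].
by rewrite Hr //; have [->|//] := eqVneq s r; lia.
Qed.

Lemma exec_inc e t r : 0 < r < K -> rep K e t -> exists t',
  exec b (translate K (Inc r)) ((- 1)%R, t) ((- 1)%R, t') /\
  rep K (sem (Inc r) e) t'.
Proof.
move=> r0 Ht; have Ht' := rep_set r0 Ht; exists (put t (Posz (e r)) (Nat.setbit (t (Posz (e r))) r)).
split=> //; apply: ExecChain; first exact: exec_scan Ht r0.
have [[Hb _ _] _] := Ht.
apply: ExecChain; first exact: (ExecAct _ MStay (Hb (e r))).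
by apply: exec_home; [case: Ht' | rewrite /=; lia].
Qed.

Lemma exec_dec e t r : 0 < r < K -> rep K e t -> exists t',
  exec b (decr K r) ((- 1)%R, t) ((- 1)%R, t') /\
  rep K (sem (Dec r) e) t'.
Proof.
move=> r0 Ht; have Ht' := rep_clear r0 Ht; eexists; split; last exact: Ht'.
apply: ExecChain; first exact: exec_scan Ht r0.
have [[Hb _ _] _] := Ht.
apply: ExecChain; first exact: (exec_left (Hb (e r))).
apply: ExecChain; first exact: (ExecAct _ MStay (Hb ((Posz (e r)) - 1)%R)).
by apply: exec_home; [case: Ht' | rewrite /=; lia].
Qed.

Lemma translate_correct c e t : wf K c -> rep K e t -> exists t',
  exec b (translate K c) ((- 1)%R, t) ((- 1)%R, t') /\ rep K (sem c e) t'.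
Proof.
elim: c e t => [|r|r|c IHc d IHd|r c IHc d IHd|r c IHc] e t.
- move=> _ Ht; exists t; split=> //; have [Hf _] := Ht.
  exact: ExecChain (exec_rightN Hf) (exec_leftN Hf).
- exact: exec_inc.
- exact: exec_dec.
- move=> /andP[wc wd] Ht; have [t1 [Hc Ht1]] := IHc _ _ wc Ht.
  have [t2 [Hd Ht2]] := IHd _ _ wd Ht1; exists t2; split=> //.
  exact: ExecChain Hc Hd.
- move=> /= /and3P[r0 wc wd] Ht; have [Hf Hr] := Ht; have [Hb _ _] := Hf.
  have [H0|H0] := boolP (0 < e r).
    have [t1 [Hc Ht1]] := IHc _ _ wc Ht; exists t1; split=> //.
    apply: ExecChain (exec_rightN Hf) _; apply: ExecThen => //; first by rewrite Hr.
    exact: ExecChain (exec_leftN Hf) Hc.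
  have [t1 [Hd Ht1]] := IHd _ _ wd Ht; exists t1; split=> //.
  apply: ExecChain (exec_rightN Hf) _; apply: ExecElse => //; first by rewrite Hr.
  exact: ExecChain (exec_leftN Hf) Hd.
case/and3P=> r0 kc wc Ht; have [Hf _] := Ht.
suff [t' [Ht' Hw]] : exists t', rep K (sem (For r c) e) t' /\
    exec b (While (Nat.testbit^~ r)
      (Chain go_left (Chain (decr K r) (Chain (translate K c) go_right))))
      (0%R, t) (0%R, t').
  exists t'; split=> //; apply: ExecChain (exec_rightN Hf) _.
  by apply: ExecChain Hw _; apply: exec_leftN; case: Ht'.
rewrite [sem _ _]/=; move En: (e r) => n; elim: n e t Ht Hf En => [|n IHn] e t Ht Hf En.
  exists t; split=> //; have [[Hb _ _] Hr] := Ht.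
  by apply: ExecStop; rewrite // (Hr 0) // En.
have [t1 [Hd Ht1]] := exec_dec r0 Ht; have [t2 [Hc Ht2]] := IHc _ _ wc Ht1.
have [Hf2 _] := Ht2.
have [|t3 [Ht3 Hw]] := IHn _ _ Ht2 Hf2; first by rewrite keepsP //= /upd eqxx En.
exists t3; split; first by rewrite iterSr.
have [[Hb _ _] Hr] := Ht.
apply: (ExecLoop (c := (0%R, t2))) Hw => //; first by rewrite (Hr 0) // En.
apply: ExecChain (exec_leftN Hf) _; apply: ExecChain Hd _; apply: ExecChain Hc _.
exact: exec_rightN.
Qed.

End Translation.

(** * Input, output and a stored constant *)

Fixpoint write_word (v : word) : prog :=
  match v with
  | [::] => Act (fun=> 0) MStay
  | x :: v' => Chain (Act (fun=> if x then 2 else 1) MRight) (Chain (write_word v') go_left)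
  end.

Lemma write_word_correct K v h t : (forall z, t z < 2 ^ K.+1) -> 1 < K ->
  exists t', [/\ exec (2 ^ K.+1) (write_word v) (h, t) (h, t'),
    forall z, t' z < 2 ^ K.+1, forall z, (z < h)%R -> t' z = t z
    & reads (Config 0 h t') v].
Proof.
move=> Hb K1; have lt4: 4 < 2 ^ K.+1 by apply: (@leq_trans (2 ^ 3)); rewrite ?leq_exp2l.
elim: v h t Hb => [|x v IHv] h t Hb /=.
  exists (put t h 0); split.
  - exact: (ExecAct (fun=> 0) MStay (Hb h)).
  - by move=> z; rewrite /put; case: eqP => // _; lia.
  - by move=> z; rewrite /put; case: eqP => // ->; lia.
  - by case=> //= _; rewrite /put addr0 eqxx.
pose s := if x then 2 else 1; pose t1 := put t h s.
have Hb1 z : t1 z < 2 ^ K.+1 by rewrite /t1 /put; case: eqP => // _; rewrite /s; case: ifP; lia.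
have [t2 [He Hb2 Hl Hr]] := IHv (h + 1)%R t1 Hb1; exists t2; split=> //.
- apply: ExecChain; first exact: (ExecAct (fun=> s) MRight (Hb h)).
  apply: ExecChain He _; have := exec_left (Hb2 (h + 1)%R).
  by congr (exec _ _ _ (_, _)); lia.
- move=> z Hz; rewrite Hl; last by lia.
  by rewrite /t1 /put; case: eqP => // E; lia.
case=> [|i] Hi /=.
  by rewrite addr0 Hl ?/t1 ?/put ?eqxx //; lia.
have /= <- := Hr i Hi; congr (t2 _); lia.
Qed.

Definition home_symbol (K : nat) := Nat.setbit 0 K.

(* The block of nonblank cells around the input is turned into a
   representation of the registers: register 1 is read off the letters [true]
   (symbol 2) of the input, register 2 off the marks (adding 4) go_left by the
   constant writer below. *)
Definition wrap (K : nat) (c : cmd) (r1 r2 : nat) (v0 v1 v2 : word) : prog :=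
  Chain go_left (Chain (While (predC1 0) go_left)
    (Chain (Act (fun=> home_symbol K) MStay)
      (Chain (translate K c) (Chain go_right
        (Cond (Nat.testbit^~ r2) (write_word v2)
          (Cond (Nat.testbit^~ r1) (write_word v1) (write_word v0))))))).

Definition writer_step (i : nat) : tm :=
  [seq Instr i.*2 s (s + 4) MRight i.+1.*2 | s <- iota 0 3].

Definition writer_exit (w : nat) : tm :=
  [seq Instr w.*2 s s MStay 1 | s <- iota 0 3].

Fixpoint writer_steps (w : nat) : tm :=
  if w is w'.+1 then writer_step w' ++ writer_steps w' else [::].

(** The constant is carried by the number of states alone. The exit comes first and the steps follow
    in descending order, because the code will be pushed from its end while the state number
    grows. *)
Definition writer (w : nat) : tm := writer_exit w ++ writer_steps w.

Lemma writer_stepsS w : writer_steps w.+1 = writer_step w ++ writer_steps w.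
Proof. by []. Qed.

Lemma writer_steps_src w : all (fun i => q_src i < w.*2) (writer_steps w).
Proof.
elim: w => // w IHw; rewrite writer_stepsS all_cat; apply/andP; split.
  by rewrite /=; lia.
by apply: sub_all IHw => i; lia.
Qed.

Lemma writer_even w : all (fun i => ~~ odd (q_src i)) (writer w).
Proof.
rewrite all_cat /= odd_double /=; elim: w => // w IHw.
by rewrite writer_stepsS all_cat IHw /= odd_double.
Qed.

Lemma writer_deterministic w : deterministic (writer w).
Proof.
have Hf (s f : nat -> nat) m (e i : nat) : deterministic
    [seq Instr i.*2 s (f s) m e | s <- iota 0 3] by exact: (deterministic_map (s := i.*2)).
have Hcat i C1 C2 : deterministic C1 -> deterministic C2 ->
    all (fun j => q_src j == i.*2) C1 -> all (fun j => q_src j < i.*2) C2 ->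
    deterministic (C1 ++ C2).
  move=> D1 D2 A1 A2; apply: (deterministic_cat (a := fun j => q_src j == i.*2)) => //.
    by move=> j k ->.
  by rewrite -all_predC; apply: sub_all A2 => j /=; lia.
have Hsteps: deterministic (writer_steps w).
  elim: w => // w IHw; rewrite writer_stepsS; apply: (Hcat w) => //.
  - exact: (deterministic_map (s := w.*2)).
  - by rewrite /= eqxx.
  - exact: writer_steps_src.
apply: (Hcat w) => //.
- exact: (deterministic_map (s := w.*2)).
- by rewrite /= eqxx.
- exact: writer_steps_src.
Qed.

Lemma size_writer w : size (writer w) = 3 * w + 3.
Proof.
rewrite size_cat /=; suff -> : size (writer_steps w) = 3 * w by lia.
by elim: w => // w IHw; rewrite writer_stepsS size_cat IHw /=; lia.
Qed.

Definition input_tape (n : nat) : int -> nat := c_tape (init (code_nat n)).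

Lemma input_tapeE n (z : nat) :
  input_tape n z = if z < n then 2 else if z == n then 1 else 0.
Proof.
rewrite /input_tape /= /symbols /code_nat map_rcons map_nseq nth_rcons size_nseq nth_nseq.
by do 2?case: ifP.
Qed.

Lemma input_tape_lt3 n z : input_tape n z < 3.
Proof. by case: z => // z; rewrite input_tapeE; do 2?case: ifP. Qed.

Definition marked_tape (n w : nat) : int -> nat :=
  fun z => input_tape n z + (if (0 <= z < w%:Z)%R then 4 else 0).

Lemma writer_correct M n w : contains M (writer w) ->
  reach M (init (code_nat n)) (Config 1 (w : int) (marked_tape n w)).
Proof.
case/contains_cat => He Hs.
have Hreach i : i <= w ->
    reach M (init (code_nat n)) (Config i.*2 (i : int) (marked_tape n i)).
  elim: i => [|i IHi] Hi.
    exists 0; rewrite /init /=; congr Config; apply: functional_extensionality => z.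
    by rewrite /marked_tape /input_tape /=; case: ifP; rewrite ?addn0 //; lia.
  apply: reach_trans (IHi (ltnW Hi)) _.
  have Hi' : contains M (writer_step i).
    have : i < w by []; elim: w Hs {He Hi IHi} => // w' IHw /contains_cat[Hs1 Hs2].
    by rewrite ltnS leq_eqVlt => /predU1P[->|/(IHw Hs2)].
  have Et : marked_tape n i i = input_tape n i.
    by rewrite /marked_tape; case: ifP; rewrite ?addn0 //; lia.
  have /Hi' Hl := in_map_iota (fun s => Instr i.*2 s (s + 4) MRight i.+1.*2) (input_tape_lt3 n i).
  rewrite -Et in Hl; have := reach_step Hl; rewrite /= Et.
  congr (reach _ _ (Config _ _ _)); first by lia.
  apply: functional_extensionality => z; rewrite /put /marked_tape.
  by case: eqP => [->|Hz]; congr addn; do 2?case: ifP => //; lia.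
apply: reach_trans (Hreach w (leqnn w)) _.
have Et : marked_tape n w w = input_tape n w.
  by rewrite /marked_tape; case: ifP; rewrite ?addn0 //; lia.
have /He Hl := in_map_iota (fun s => Instr w.*2 s s MStay 1) (input_tape_lt3 n w).
by rewrite -Et in Hl; have := reach_step Hl; rewrite /= put_same.
Qed.

Definition input_env (n w : nat) : env :=
  fun r => if r == 1 then n else if r == 2 then w else 0.

Lemma testbit_small x r : x < 8 -> 2 < r -> Nat.testbit x r = false.
Proof. by move=> Hx Hr; apply: (@testbit_ltn_exp2 _ 3). Qed.

Lemma rep_input K n w : 2 < K ->
  rep K (input_env n w) (put (marked_tape n w) (- 1)%R (home_symbol K)).
Proof.
move=> K2; have lt8 : 8 <= 2 ^ K.+1.
  by apply: (@leq_trans (2 ^ 3)); rewrite ?leq_exp2l //; lia.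
have Hm z : marked_tape n w z < 8.
  by rewrite /marked_tape; have := input_tape_lt3 n z; case: ifP; lia.
split; first split=> [z|z|].
- rewrite /put; case: eqP => _; last by apply: leq_trans lt8.
  by apply: setbit_bound => //; rewrite expn_gt0.
- by rewrite /put /=; apply: testbit_small.
- by rewrite /put eqxx Nat.setbit_eqb Nat.eqb_refl.
move=> z r /andP[r0 rK]; have Em : put (marked_tape n w) (- 1)%R (home_symbol K) z =
    (if z < n then 2 else if z == n then 1 else 0) + (if z < w then 4 else 0).
  by rewrite /put /= /marked_tape input_tapeE; congr addn; case: ifP; case: ifP; lia.
rewrite Em {Em}; case: r r0 rK => [//|[|[|r]]] _ rK.
- by case: (ltnP z n) => _; [|case: (z =P n) => _]; case: (ltnP z w).
- by case: (ltnP z n) => _; [|case: (z =P n) => _]; case: (ltnP z w).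
- by rewrite testbit_small //; case: (ltnP z n) => _; [|case: (z =P n) => _]; case: (ltnP z w).
Qed.

Definition machine (K : nat) (c : cmd) (r1 r2 : nat) (v0 v1 v2 : word) : tm :=
  let Q := wrap K c r1 r2 v0 v1 v2 in compile (2 ^ K.+1) Q 0 (states Q).*2.+1.

Theorem machine_correct K c r1 r2 v0 v1 v2 w n :
  wf K c -> 2 < K -> 0 < r1 < K -> 0 < r2 < K ->
  let e := sem c (input_env n w) in
  outputs (machine K c r1 r2 v0 v1 v2 ++ writer w) (code_nat n)
    (if 0 < e r2 then v2 else if 0 < e r1 then v1 else v0).
Proof.
move=> wc K2 Hr1 Hr2 e; set M := _ ++ _; pose b := 2 ^ K.+1.
set v := (X in outputs _ _ X).
have HM : contains M (machine K c r1 r2 v0 v1 v2) /\ contains M (writer w).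
  apply: contains_cat => i iM; apply: lookup_mem => //.
  apply: (deterministic_cat (a := fun i => odd (q_src i))).
  - by move=> i' j ->.
  - exact: compile_deterministic.
  - exact: writer_deterministic.
  - by apply: sub_all (compile_src _ _ _ _) => j /andP[].
  - by rewrite -all_predC; apply: writer_even.
have Hm z : marked_tape n w z < b.
  have : marked_tape n w z < 8.
    by rewrite /marked_tape; have := input_tape_lt3 n z; case: ifP; lia.
  by move/leq_trans; apply; apply: (@leq_trans (2 ^ 3)); rewrite ?leq_exp2l //; lia.
have [t1 [He Ht1]] := translate_correct wc (rep_input n w K2).
have [[Hb1 H01 H11] Hr] := Ht1.
have [t2 [Hw Hb2 _ Hreads]] := write_word_correct v 0%R Hb1 (ltnW K2).
(* All cells from 0 to [w - 1] carry a mark and cell -1 is blank, so the first blank left of cell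
   [w] is the home cell. *)
have Hloop i : i <= w -> exec b (While (predC1 0) go_left)
    ((Posz i - 1)%R, marked_tape n w) ((- 1)%R, marked_tape n w).
  elim: i => [|i IHi] Hi; first exact: ExecStop.
  have -> : (Posz i.+1 - 1)%R = i by lia.
  apply: (@ExecLoop _ _ _ _ _ ((Posz i - 1)%R, marked_tape n w)) => //.
  - by rewrite /= /marked_tape; case: ifP; lia.
  - exact: (exec_left (Hm i)).
  - by apply: IHi; lia.
have Hexec : exec b (wrap K c r1 r2 v0 v1 v2) (w : int, marked_tape n w) (0%R, t2).
  apply: ExecChain; first exact: (exec_left (Hm w)).
  apply: ExecChain; first exact: Hloop.
  apply: ExecChain; first exact: (ExecAct (fun=> home_symbol K) MStay (Hm (- 1)%R)).
  apply: ExecChain He _; apply: ExecChain; first by apply: exec_rightN; case: Ht1.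
  move: Hw; rewrite /v; case: ifP => H2 Hw; first by apply: ExecThen => //; rewrite (Hr 0).
  apply: ExecElse; rewrite // ?(Hr 0) // ?H2 //.
  move: Hw; case: ifP => H1 Hw; first by apply: ExecThen => //; rewrite (Hr 0).
  by apply: ExecElse => //; rewrite (Hr 0) // H1.
have [m Em] : reach M (init (code_nat n))
    (Config (states (wrap K c r1 r2 v0 v1 v2)).*2.+1 0%R t2).
  apply: reach_trans (writer_correct n HM.2) _.
  exact: (compile_correct (s := 0) Hexec HM.1).
exists m; rewrite Em; split; last exact: Hreads.
rewrite /step lookup_out // all_cat; apply/andP; split.
  apply: sub_all (compile_src _ _ _ _) => i /andP[Hodd /andP[_ Hlt]].
  by apply: contraTneq Hlt => ->; rewrite /= uphalf_double -leqNgt.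
by apply: sub_all (writer_even w) => i; apply: contraNneq => ->; rewrite /= odd_double.
Qed.

(** * Stack arithmetic with registers *)

Lemma upd_id e r v : e r = v -> upd e r v = e.
Proof. by move=> <-; apply: functional_extensionality => s; rewrite /upd; case: eqP => [->|]. Qed.

Lemma upd_upd e r u v : upd (upd e r u) r v = upd e r v.
Proof. by apply: functional_extensionality => s; rewrite /upd; case: eqP. Qed.

Lemma upd_eq e r v : upd e r v r = v.
Proof. by rewrite /upd eqxx. Qed.

Lemma upd_neq e r s v : s != r -> upd e r v s = e s.
Proof. by rewrite /upd => /negPf->. Qed.

Lemma updC e r s u v : r != s -> upd (upd e r u) s v = upd (upd e s v) r u.
Proof.
move=> rs; apply: functional_extensionality => x; rewrite /upd.
by case: eqP => // ->; case: eqP => // E; rewrite E eqxx in rs.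
Qed.

Lemma semThen c d e : sem (Then c d) e = sem d (sem c e).
Proof. by []. Qed.

Lemma semInc r e : sem (Inc r) e = upd e r (e r).+1.
Proof. by []. Qed.

Lemma semFor r c e :
  sem (For r c) e = iter (e r) (fun e' => sem c (upd e' r (e' r).-1)) e.
Proof. by []. Qed.

Fixpoint seqc (cs : seq cmd) : cmd := if cs is c :: cs' then Then c (seqc cs') else Skip.

Definition spread (x : nat) (ts : seq nat) : cmd := For x (seqc [seq Inc t | t <- ts]).

Definition incs (r n : nat) : cmd := seqc (nseq n (Inc r)).

(* Register [r] is zero when the selected branch starts. *)
Fixpoint switch (r : nat) (cs : seq cmd) : cmd :=
  if cs is c :: cs' then If r (Then (Dec r) (switch r cs')) c else Skip.

Lemma sem_seqc_Inc ts e : sem (seqc [seq Inc t | t <- ts]) e = fun r => e r + count_mem r ts.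
Proof.
elim: ts e => [|t ts IHts] e /=; apply: functional_extensionality => r; first by rewrite addn0.
by rewrite IHts /upd [r == t]eq_sym; case: eqP => [->|_] //=; lia.
Qed.

Lemma sem_spread x ts e : x \notin ts ->
  sem (spread x ts) e = fun r => if r == x then 0 else e r + count_mem r ts * e x.
Proof.
move=> xts /=; suff H n : n <= e x ->
    iter n (fun e' => sem (seqc [seq Inc t | t <- ts]) (upd e' x (e' x).-1)) e =
    fun r => if r == x then e x - n else e r + count_mem r ts * n.
  by rewrite H //; apply: functional_extensionality => r; rewrite subnn.
elim: n => [|n IHn] Hn /=; apply: functional_extensionality => r.
  by rewrite muln0 addn0 subn0; case: eqP => [->|].
rewrite IHn ?(ltnW Hn) // sem_seqc_Inc /upd eqxx; case: (eqVneq r x) => [->|_].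
  by rewrite (count_memPn xts); lia.
by rewrite mulnS [X in _ = _ + X]addnC addnA.
Qed.

Lemma sem_spread1 x t k e : x != t ->
  sem (spread x (nseq k t)) e = upd (upd e x 0) t (e t + k * e x).
Proof.
move=> xt; rewrite sem_spread; last by rewrite mem_nseq (negPf xt) andbF.
apply: functional_extensionality => r; rewrite count_nseq /upd /= [t == r]eq_sym.
by case: (eqVneq r t) => [->|_]; rewrite ?mul0n ?addn0 // mul1n eq_sym (negPf xt).
Qed.

Lemma sem_move x t e : x != t ->
  sem (spread x [:: t]) e = upd (upd e x 0) t (e t + e x).
Proof. by move=> xt; rewrite (sem_spread1 1) ?mul1n. Qed.

Lemma sem_incs r n e : sem (incs r n) e = upd e r (e r + n).
Proof.
rewrite /incs -map_nseq sem_seqc_Inc; apply: functional_extensionality => s.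
by rewrite count_nseq /upd /= [r == s]eq_sym; case: eqP => [->|]; rewrite ?mul1n ?mul0n ?addn0.
Qed.

Lemma sem_switch r cs e : e r < size cs ->
  sem (switch r cs) e = sem (nth Skip cs (e r)) (upd e r 0).
Proof.
elim: cs e => //= c cs IHcs e Hr; case: posnP => [E|E]; first by rewrite E /= upd_id.
rewrite IHcs /= upd_eq; last by lia.
by rewrite upd_upd; case: (e r) E.
Qed.

Section Stack.
Variables (B X T : nat).
Hypotheses (B2 : 2 < B) (XT : X != T).

(** A base-[B] numeral whose lowest digit is the top of the stack. Digit 0 is the blank, so an
    infinite blank tail costs nothing. *)
Definition stack (s : seq nat) (x : nat) : nat := foldr (fun d y => d + B * y) x s.

Definition push (d : nat) : cmd :=
  Then (spread X (nseq B T)) (Then (spread T [:: X]) (incs X d)).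

Lemma sem_push d e : e T = 0 -> sem (push d) e = upd e X (d + B * e X).
Proof.
move=> T0; rewrite /push !semThen.
have TX : T != X by rewrite eq_sym.
rewrite sem_spread1 // sem_move // sem_incs; apply: functional_extensionality => r; rewrite /upd !eqxx.
rewrite ?(negPf TX) ?(negPf XT) T0; case: (eqVneq r X) => [_|_]; first by lia.
by case: (eqVneq r T) => [->|_] //; rewrite T0.
Qed.

(** Division by [B] by counting: while [X] runs down, [C] cycles through the residues and [T] counts
    the completed cycles. The last branch leaves [C] at 0, to which [switch] has reset it. *)
Definition pop (C : nat) : cmd :=
  Then (For X (switch C [seq if j.+1 < B then incs C j.+1 else Inc T | j <- iota 0 B]))
       (spread T [:: X]).

Lemma dvdn_succ m : (B %| m.+1) = ((m %% B).+1 == B).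
Proof.
rewrite /dvdn -addn1 -modnDml addn1; have: m %% B < B by rewrite ltn_mod; lia.
rewrite leq_eqVlt => /predU1P[->|lt]; first by rewrite modnn !eqxx.
by rewrite modn_small // (ltn_eqF lt).
Qed.

Lemma sem_pop C e : C != X -> C != T -> e T = 0 -> e C = 0 ->
  sem (pop C) e = upd (upd e X (e X %/ B)) C (e X %% B).
Proof.
move=> CX CT T0 C0; have TX : T != X by rewrite eq_sym.
have XC : X != C by rewrite eq_sym.
have TC : T != C by rewrite eq_sym.
rewrite /pop semThen semFor.
set body := (F in iter _ F _).
have -> : iter (e X) body e = upd (upd (upd e X 0) C (e X %% B)) T (e X %/ B).
  suff H n : n <= e X -> iter n body e = upd (upd (upd e X (e X - n)) C (n %% B)) T (n %/ B).
    by rewrite H // subnn.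
  elim: n => [|n IHn] Hn; first by rewrite div0n mod0n subn0 !upd_id // ?upd_id.
  rewrite iterS IHn ?(ltnW Hn) // {1}/body.
  have lt_nB : n %% B < B by rewrite ltn_mod; lia.
  rewrite upd_neq // upd_neq // upd_eq.
  set e' := upd _ X _; have Ce' : e' C = n %% B by rewrite /e' !(upd_neq _ _ CX) upd_neq // upd_eq.
  rewrite sem_switch Ce' ?size_map ?size_iota // (nth_map 0) ?size_iota // nth_iota // add0n.
  rewrite modnS divnS ?dvdn_succ; last by lia.
  apply: functional_extensionality => r; case: (ltnP (n %% B).+1 B) => Hlt.
    rewrite sem_incs (ltn_eqF Hlt) upd_eq /e' /upd.
    case: (eqVneq r C) => [->|rC]; first by rewrite (negPf CT).
    case: (eqVneq r X) => [->|rX]; first by rewrite (negPf XT); lia.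
    by case: (eqVneq r T).
  have -> : (n %% B).+1 == B by rewrite eqn_leq lt_nB Hlt.
  rewrite /= /upd /e' (negPf TC) /upd (negPf TX) eqxx add1n.
  case: (eqVneq r T) => // rT; case: (eqVneq r C) => // rC.
  by case: (eqVneq r X) => // _; lia.
rewrite sem_move //; apply: functional_extensionality => r; rewrite /upd !eqxx (negPf XT) (negPf XC).
case: (eqVneq r X) => [->|rX]; first by rewrite (negPf XC); lia.
by case: (eqVneq r T) => [->|//]; rewrite (negPf TC).
Qed.

Fixpoint push_word (v : word) : cmd :=
  if v is x :: v' then Then (push_word v') (push (if x then 2 else 1)) else Skip.

Lemma sem_push_word v e : e T = 0 ->
  sem (push_word v) e = upd e X (stack (symbols v) (e X)).
Proof.
move=> T0; have TX : T != X by rewrite eq_sym.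
elim: v => [|x v IHv]; first by rewrite /= upd_id.
by rewrite [push_word _]/= semThen IHv sem_push ?upd_eq ?upd_upd // upd_neq.
Qed.

Definition push_ones (A T2 : nat) : cmd :=
  Then (For A (Then (push 2) (Inc T2))) (spread T2 [:: A]).

Lemma sem_push_ones A T2 e :
  A != X -> A != T -> T2 != X -> T2 != T -> T2 != A -> e T = 0 -> e T2 = 0 ->
  sem (push_ones A T2) e = upd e X (stack (symbols (nseq (e A) true)) (e X)).
Proof.
move=> AX AT T2X T2T T2A T0 T20.
have AT2 : A != T2 by rewrite eq_sym.
have XA : X != A by rewrite eq_sym.
have XT2 : X != T2 by rewrite eq_sym.
have TX : T != X by rewrite eq_sym.
have TT2 : T != T2 by rewrite eq_sym.
have TA : T != A by rewrite eq_sym.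
rewrite /push_ones semThen semFor.
set body := (F in iter _ F _).
have -> : iter (e A) body e =
    upd (upd (upd e X (stack (symbols (nseq (e A) true)) (e X))) A 0) T2 (e A).
  suff H n : n <= e A -> iter n body e =
      upd (upd (upd e X (stack (symbols (nseq n true)) (e X))) A (e A - n)) T2 n.
    by rewrite H // subnn.
  elim: n => [|n IHn] Hn.
    by rewrite /= subn0 !upd_id // ?upd_id // ?upd_neq.
  rewrite iterS IHn ?(ltnW Hn) // {1}/body semThen.
  rewrite upd_neq // upd_eq sem_push; last by rewrite !upd_neq.
  rewrite (upd_neq _ _ XA) (upd_neq _ _ XT2) (upd_neq _ _ XA) upd_eq semInc.
  apply: functional_extensionality => r; rewrite /upd eqxx !(negPf T2X) !(negPf T2A).
  case: (eqVneq r T2) => // _; case: (eqVneq r X) => [->|_]; first by rewrite (negPf XA).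
  by case: (eqVneq r A) => // _; lia.
rewrite sem_move //; apply: functional_extensionality => r; rewrite /upd !eqxx (negPf AT2).
case: (eqVneq r A) => [->|_]; first by rewrite (negPf AX); lia.
by case: (eqVneq r T2) => [->|//]; rewrite (negPf T2X) T20.
Qed.

End Stack.

Lemma keeps_seqc r cs : keeps r (seqc cs) = all (keeps r) cs.
Proof. by elim: cs => //= c cs ->. Qed.

Lemma wf_seqc K cs : wf K (seqc cs) = all (wf K) cs.
Proof. by elim: cs => //= c cs ->. Qed.

Lemma keeps_spread r x ts : keeps r (spread x ts) = (x != r) && (r \notin ts).
Proof.
rewrite /= keeps_seqc all_map; congr andb; elim: ts => //= t ts ->.
by rewrite inE negb_or eq_sym.
Qed.

Lemma wf_spread K x ts :
  wf K (spread x ts) = [&& 0 < x < K, x \notin ts & all (fun t => 0 < t < K) ts].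
Proof.
rewrite /= keeps_seqc wf_seqc !all_map.
congr [&& _, _ & _]; elim: ts => //= t ts ->.
by rewrite inE negb_or eq_sym.
Qed.

Lemma keeps_incs r x n : x != r -> keeps r (incs x n).
Proof. by move=> xr; rewrite keeps_seqc all_nseq /= xr orbT. Qed.

Lemma wf_incs K x n : 0 < x < K -> wf K (incs x n).
Proof. by move=> xK; rewrite wf_seqc all_nseq /= xK orbT. Qed.

Lemma keeps_switch r x cs : x != r -> all (keeps r) cs -> keeps r (switch x cs).
Proof. by move=> xr; elim: cs => //= c cs IHcs /andP[-> /IHcs->]; rewrite xr. Qed.

Lemma wf_switch K x cs : 0 < x < K -> all (wf K) cs -> wf K (switch x cs).
Proof. by move=> xr; elim: cs => //= c cs IHcs /andP[-> /IHcs->]; rewrite xr. Qed.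

Lemma keeps_push B X T d r : X != r -> T != r -> keeps r (push B X T d).
Proof.
move=> Xr Tr; rewrite [keeps _ _]/= -!/(keeps _ _) !(keeps_seqc _ (map _ _)) !all_map.
by rewrite !all_nseq /= -/(incs X d) keeps_incs // Xr Tr !orbT.
Qed.

Lemma wf_push K B X T d : X != T -> 0 < X < K -> 0 < T < K -> wf K (push B X T d).
Proof.
move=> XT XK TK; rewrite -[wf _ _]/(wf K (spread X (nseq B T)) && (wf K (spread T [:: X]) && wf K (incs X d))).
by rewrite !wf_spread wf_incs // mem_nseq (negPf XT) andbF inE eq_sym XT all_nseq /= XK TK orbT.
Qed.

Lemma keeps_pop B X T C r : X != r -> T != r -> C != r -> keeps r (pop B X T C).
Proof.
move=> Xr Tr Cr; rewrite -[keeps _ _]/(((X != r) && keeps r (switch C _)) && keeps r (spread T [:: X])).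
have rX : r != X by rewrite eq_sym.
rewrite keeps_spread Xr Tr inE rX !andbT andTb; apply: keeps_switch => //.
by rewrite all_map; apply/allP => j _ /=; case: ifP => _; rewrite ?keeps_incs //= Tr.
Qed.

Lemma wf_pop K B X T C : X != T -> X != C ->
  0 < X < K -> 0 < T < K -> 0 < C < K -> wf K (pop B X T C).
Proof.
move=> XT XC XK TK CK; have TX : T != X by rewrite eq_sym.
have Hk : keeps X (switch C [seq if j.+1 < B then incs C j.+1 else Inc T | j <- iota 0 B]).
  apply: keeps_switch; rewrite 1?eq_sym // all_map; apply/allP => j _ /=.
  by case: ifP => _; rewrite ?keeps_incs // 1?eq_sym.
have Hw : wf K (switch C [seq if j.+1 < B then incs C j.+1 else Inc T | j <- iota 0 B]).
  apply: wf_switch => //; rewrite all_map; apply/allP => j _ /=.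
  by case: ifP => _; rewrite ?wf_incs.
have Hs : wf K (spread T [:: X]) by rewrite wf_spread TK inE TX /= XK.
by apply/andP; split=> //; apply/and3P.
Qed.

Lemma keeps_push_word B X T v r : X != r -> T != r -> keeps r (push_word B X T v).
Proof. by move=> Xr Tr; elim: v => // x v IHv; rewrite -[keeps _ _]/(keeps r (push_word B X T v) && keeps r (push B X T _)) IHv keeps_push. Qed.

Lemma wf_push_word K B X T v : X != T -> 0 < X < K -> 0 < T < K ->
  wf K (push_word B X T v).
Proof. by move=> XT XK TK; elim: v => // x v IHv; rewrite -[wf _ _]/(wf K (push_word B X T v) && wf K (push B X T _)) IHv wf_push. Qed.

Lemma keeps_push_ones B X T A U r :
  X != r -> T != r -> A != r -> U != r -> keeps r (push_ones B X T A U).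
Proof.
move=> Xr Tr Ar Ur.
rewrite -[keeps _ _]/((A != r) && (keeps r (push B X T 2) && (U != r)) && keeps r (spread U [:: A])).
have rA : r != A by rewrite eq_sym.
by rewrite keeps_spread keeps_push // Ar Ur inE rA.
Qed.

Lemma wf_push_ones K B X T A U : X != T -> A != U -> A != X -> A != T ->
  0 < X < K -> 0 < T < K -> 0 < A < K -> 0 < U < K -> wf K (push_ones B X T A U).
Proof.
move=> XT AU AX AT XK TK AK UK.
have Hk : keeps A (push B X T 2) by apply: keeps_push; rewrite eq_sym.
have Hw : wf K (push B X T 2) by apply: wf_push.
have Hs : wf K (spread U [:: A]) by rewrite wf_spread UK inE eq_sym AU /= AK.
have UA : U != A by rewrite eq_sym.
apply/andP; split=> //; apply/and3P; split=> //; apply/andP; split=> //.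
Qed.

Lemma sem_for (P : nat -> env -> Prop) r c e : P 0 e ->
  (forall j e', j < e r -> P j e' -> P j.+1 (sem c (upd e' r (e' r).-1))) ->
  P (e r) (sem (For r c) e).
Proof.
move=> P0 PS; rewrite semFor; set body := (F in iter _ F _).
suff H n : n <= e r -> P n (iter n body e) by exact: H.
by elim: n => // n IHn Hn; rewrite iterS; apply: PS => //; apply: IHn; apply: ltnW.
Qed.

(** * A machine simulating a decider on its own code *)

(* rN and rW hold the input and the stored constant; rX is the code under
   construction, then the right half of the simulated tape; rL its left half,
   rC the scanned symbol and rS the simulated state; rE records the answer
   "false"; rt, rk, rf are the clock that recognizes the exponents of the series;
   rO1 and rO2 select the output.  The others are copies and scratch. *)
Local Notation rN := 1.
Local Notation rW := 2.
Local Notation rX := 3.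
Local Notation rT := 4.
Local Notation rU := 5.
Local Notation rC := 6.
Local Notation rL := 7.
Local Notation rS := 8.
Local Notation rA := 9.
Local Notation rE := 10.
Local Notation rW1 := 11.
Local Notation rW2 := 12.
Local Notation rW3 := 13.
Local Notation rW4 := 14.
Local Notation rN1 := 15.
Local Notation rN2 := 16.
Local Notation rN0 := 17.
Local Notation rt := 18.
Local Notation rk := 19.
Local Notation rf := 20.
Local Notation rO1 := 21.
Local Notation rO2 := 22.
Local Notation rY := 23.
Local Notation K := 24.

Lemma stack_cat B s1 s2 x : stack B (s1 ++ s2) x = stack B s1 (stack B s2 x).
Proof. by rewrite /stack foldr_cat. Qed.

Lemma symbols_cat v1 v2 : symbols (v1 ++ v2) = symbols v1 ++ symbols v2.
Proof. exact: map_cat. Qed.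

(** Letters are the nonzero digits 1 and 2, so the numeral is at least as large as the length of its
    word. This lets [w] itself serve as the loop bound of [unreverse], with no length stored. *)
Lemma size_le_stack B v x : 0 < B -> size v <= stack B (symbols v) x.
Proof.
move=> B0; elim: v => //= b v IHv; set y := stack _ _ _.
have: y <= B * y by rewrite leq_pmull.
by rewrite /= in IHv; case: b; lia.
Qed.

(** * Spelling out the machine's own code, then running the decider on it *)

Section Program.
Variable B : nat.
Hypothesis B2 : 2 < B.

Definition copy_inputs : cmd :=
  Then (spread rW [:: rW1; rW2; rW3; rW4]) (spread rN [:: rN1; rN2; rN0]).

Definition push_seg (v : word) : cmd :=
  Then (push_word B rX rT v) (push_ones B rX rT rA rU).

(** The middle of the code of a writer instruction, free of its state number: the leading [false]
    closes the unary source state, and the ones around the segment are pushed separately from [rA],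
    which holds [i.*2]. *)
Definition step_seg (s : nat) : word :=
  false :: code_nat s ++ code_nat (s + 4) ++ code_move MRight.

Definition exit_seg (s : nat) : word :=
  false :: code_nat s ++ code_nat s ++ code_move MStay ++ code_nat 1.

Definition push_step (s : nat) : cmd :=
  Then (push_seg [:: true; true; false]) (push_seg (step_seg s)).

Definition push_writer : cmd :=
  Then (For rW1 (Then (Then (push_step 2) (Then (push_step 1) (push_step 0)))
                      (incs rA 2)))
    (Then (push_seg (exit_seg 2))
      (Then (push_seg (exit_seg 1)) (push_seg (exit_seg 0)))).

Definition unreverse : cmd :=
  For rW3 (Then (pop B rW2 rT rC)
    (switch rC [:: Skip; push B rX rT 1; push B rX rT 2])).

Definition push3 : cmd := push_word B rX rT [:: true; true; true].

Definition push_size : cmd := Then (For rW4 push3) push3.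

Lemma sem_push_seg v e : e rT = 0 -> e rU = 0 ->
  sem (push_seg v) e = upd e rX (stack B (symbols (nseq (e rA) true ++ v)) (e rX)).
Proof.
move=> T0 U0; rewrite /push_seg semThen sem_push_word // sem_push_ones //.
by rewrite upd_eq upd_upd symbols_cat stack_cat.
Qed.

Lemma sem_push_seg_upd v e x : e rT = 0 -> e rU = 0 ->
  sem (push_seg v) (upd e rX x) =
  upd e rX (stack B (symbols (nseq (e rA) true ++ v)) x).
Proof. by move=> T0 U0; rewrite sem_push_seg // upd_eq upd_upd. Qed.

Lemma code_natS n v : code_nat n ++ v = nseq n true ++ false :: v.
Proof. by rewrite /code_nat cat_rcons. Qed.

Lemma code_step i s :
  code_instr (Instr i.*2 s (s + 4) MRight i.+1.*2) =
  nseq i.*2 true ++ step_seg s ++ nseq i.*2 true ++ [:: true; true; false].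
Proof.
have -> : nseq i.*2 true ++ [:: true; true; false] = code_nat i.+1.*2.
  by rewrite /code_nat doubleS -addn2 nseqD rcons_cat.
by rewrite /code_instr /step_seg /q_src code_natS /= -!catA.
Qed.

Lemma code_exit i s :
  code_instr (Instr i.*2 s s MStay 1) = nseq i.*2 true ++ exit_seg s.
Proof. by rewrite /code_instr /exit_seg /q_src code_natS. Qed.

Lemma sem_push_step s i e x : e rT = 0 -> e rU = 0 -> e rA = i.*2 ->
  sem (push_step s) (upd e rX x) =
  upd e rX (stack B (symbols (code_instr (Instr i.*2 s (s + 4) MRight i.+1.*2))) x).
Proof.
move=> T0 U0 EA; rewrite (semThen (push_seg _) (push_seg _)) !sem_push_seg_upd // EA code_step.
by rewrite !symbols_cat !stack_cat.
Qed.

Definition code_table (C : tm) : word := flatten [seq code_instr i | i <- C].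

Lemma code_table_cat C1 C2 : code_table (C1 ++ C2) = code_table C1 ++ code_table C2.
Proof. by rewrite /code_table map_cat flatten_cat. Qed.

Lemma code_table3 (f : nat -> instr) : code_table [seq f s | s <- iota 0 3] =
  code_instr (f 0) ++ code_instr (f 1) ++ code_instr (f 2).
Proof. by rewrite /code_table /= cats0. Qed.

Lemma sem_push_writer e : e rT = 0 -> e rU = 0 -> e rA = 0 ->
  sem push_writer e = upd (upd (upd e rW1 0) rA (e rW1).*2) rX
    (stack B (symbols (code_table (writer (e rW1)))) (e rX)).
Proof.
move=> T0 U0 A0; rewrite (semThen (For _ _)).
set c := Then _ (incs rA 2).
have -> : sem (For rW1 c) e = upd (upd (upd e rW1 0) rA (e rW1).*2) rX
    (stack B (symbols (code_table (writer_steps (e rW1)))) (e rX)).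
  pose P n e' := e' = upd (upd (upd e rW1 (e rW1 - n)) rA n.*2) rX
    (stack B (symbols (code_table (writer_steps n))) (e rX)).
  have := @sem_for P rW1 c e; rewrite /P subnn; apply.
    by rewrite /= subn0 !upd_id // ?upd_neq // ?upd_id.
  move=> j e' Hj ->; rewrite upd_neq // upd_neq // upd_eq (updC _ _ _ (_ : 3 != 11)) //.
  rewrite (semThen _ (incs rA 2)) (semThen (push_step 2) _) (semThen (push_step 1) _).
  rewrite !(sem_push_step _ (i := j)) // sem_incs.
  rewrite writer_stepsS code_table_cat symbols_cat stack_cat.
  rewrite code_table3 !symbols_cat !stack_cat.
  apply: functional_extensionality => r; rewrite /upd !eqxx /=.
  case: (eqVneq r rA) => [->|_] /=; first by lia.
  by case: (eqVneq r rX) => // _; case: (eqVneq r rW1) => // _; lia.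
rewrite (semThen (push_seg _) (Then _ _)) (semThen (push_seg _) (push_seg _)).
rewrite !sem_push_seg_upd //.
by rewrite code_table_cat symbols_cat stack_cat code_table3 !code_exit !symbols_cat !stack_cat.
Qed.

Lemma sem_unreverse v x e : e rT = 0 -> e rC = 0 -> e rX = x ->
  e rW2 = stack B (symbols v) 0 -> size v <= e rW3 ->
  sem unreverse e =
    upd (upd (upd e rW3 0) rW2 0) rX (stack B (rev (symbols v)) x).
Proof.
move=> T0 C0 Ex EW2 Hv; set s := symbols v.
have Hs : all (fun d => 0 < d < 3) s by rewrite /s; elim: (v) => //= b v' ->; case: b.
rewrite /unreverse; set c := Then _ _.
pose P n e' := e' = upd (upd (upd e rW3 (e rW3 - n)) rW2 (stack B (drop n s) 0)) rX
  (stack B (rev (take n s)) x).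
have := @sem_for P rW3 c e; rewrite /P subnn.
have Hs3 : size s <= e rW3 by rewrite size_map.
rewrite (drop_oversize Hs3) (take_oversize Hs3); apply.
  by rewrite drop0 take0 /= subn0 !upd_id // ?upd_neq // ?upd_id.
move=> j e' Hj ->; rewrite upd_neq // upd_neq // upd_eq.
set e1 := upd _ rW3 _.
have Ee1 : e1 = upd (upd (upd e rW3 (e rW3 - j.+1)) rW2 (stack B (drop j s) 0)) rX
    (stack B (rev (take j s)) x).
  by apply: functional_extensionality => r; rewrite /e1 /upd; case: (eqVneq r rW3) => [->|_] //=; lia.
rewrite {e1}Ee1 /c semThen sem_pop //.
set E := upd (upd (upd e _ _) _ _) _ _; have -> : E rW2 = stack B (drop j s) 0 by [].
(* Once the word is used up, the popped digit is 0, on which the switch does nothing; hence any loop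
   bound at least as large as the length is good enough. *)
have [lt_js|le_sj] := ltnP j (size s); last first.
  rewrite !drop_oversize ?(leq_trans le_sj) // !take_oversize ?(leq_trans le_sj) //.
  rewrite sem_switch ?upd_eq /= ?div0n ?mod0n //.
  rewrite [sem (nth _ _ _)]/=.
  apply: functional_extensionality => r; rewrite /E drop_oversize // take_oversize // /upd.
  case: (eqVneq r rC) => [->|/negPf n1]; first by rewrite /= C0.
by rewrite ?n1; case: (eqVneq r rW2) => [->|/negPf n2]; rewrite ?n2. 
rewrite (drop_nth 0 lt_js) (take_nth 0 lt_js) rev_rcons.
set d := nth 0 s j.
have /andP[d0 d3] : 0 < d < 3 by rewrite (all_nthP _ Hs).
have dB : d < B by apply: leq_trans B2.
set y := stack B (drop _ _) _.
have -> : stack B (d :: drop j.+1 s) 0 = y * B + d by rewrite /= addnC mulnC.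
rewrite divnMDl ?(leq_trans _ B2) // divn_small // addn0 modnMDl modn_small //.
rewrite sem_switch ?upd_eq //.
have -> : nth Skip [:: Skip; push B rX rT 1; push B rX rT 2] d = push B rX rT d.
  by case: (d) d0 d3 => [|[|[|]]].
rewrite sem_push //; apply: functional_extensionality => r; rewrite /E /upd.
case: (eqVneq r rX) => [_|n1] //.
case: (eqVneq r rC) => [->|n2]; first by rewrite C0.
by case: (eqVneq r rW2).
Qed.

Lemma sem_push3 e : e rT = 0 -> sem push3 e = upd e rX (stack B (symbols (nseq 3 true)) (e rX)).
Proof. exact: sem_push_word. Qed.

Lemma sem_push_size w x e : e rT = 0 -> e rW4 = w -> e rX = x ->
  sem push_size e = upd (upd e rW4 0) rX
    (stack B (symbols (nseq (3 * w + 3) true)) x).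
Proof.
move=> T0 <- <-; rewrite /push_size semThen.
have -> : sem (For rW4 push3) e = upd (upd e rW4 0) rX
    (stack B (symbols (nseq (3 * e rW4) true)) (e rX)).
  pose P n e' := e' = upd (upd e rW4 (e rW4 - n)) rX
    (stack B (symbols (nseq (3 * n) true)) (e rX)).
  have := @sem_for P rW4 push3 e; rewrite /P subnn; apply.
    by rewrite /= subn0 !upd_id // ?upd_neq.
  move=> j e' Hj ->; rewrite sem_push3 //; apply: functional_extensionality => r.
  have -> : 3 * j.+1 = 3 + 3 * j by lia.
  rewrite nseqD symbols_cat stack_cat /upd.
  by case: (eqVneq r rX) => // _; case: (eqVneq r rW4) => //= _; lia.
rewrite sem_push3 //; apply: functional_extensionality => r.
rewrite addnC nseqD symbols_cat stack_cat /upd.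
by case: (eqVneq r rX).
Qed.

(* The number [w] in register 2 encodes, reversed, the code of a table [C]; the
   code of [C ++ writer w], the machine that wrote [w], is assembled from its
   end, so that pushing suffices. *)
Definition self_code : cmd := Then copy_inputs (Then push_writer (Then unreverse push_size)).

Definition loaded (n w : nat) : env :=
  fun r => if r \in [:: rW1; rW2; rW3; rW4] then w
           else if r \in [:: rN1; rN2; rN0] then n else 0.

Lemma sem_copy_inputs n w : sem copy_inputs (input_env n w) = loaded n w.
Proof.
rewrite /copy_inputs semThen !sem_spread //; apply: functional_extensionality => r.
rewrite /loaded /input_env !inE /=.
do 24?[case: r => [|r]; first by rewrite /= ?add0n ?addn0 ?mul1n ?mul0n ?addn0].
by [].
Qed.

(** The length of the table comes first and in unary, so extending the table only adds ones in front
    and instructions at the end; the code of [C1] survives as a block. *)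
Lemma code_tm_cat C1 C2 :
  code_tm (C1 ++ C2) = nseq (size C2) true ++ code_tm C1 ++ code_table C2.
Proof.
rewrite /code_tm /code_seq -!/(code_table _) code_table_cat size_cat !code_natS.
by rewrite -catA /= addnC nseqD -catA.
Qed.

Lemma sem_self_code (C : tm) n w :
  w = stack B (symbols (rev (code_tm C))) 0 ->
  exists e, [/\ sem self_code (input_env n w) = e,
    e rX = stack B (symbols (code_tm (C ++ writer w))) 0,
    [/\ e rN1 = n, e rN2 = n & e rN0 = n] &
    all (fun r => e r == 0) [:: rT; rU; rC; rL; rS; rE; rt; rk; rf; rO1; rO2; rY]].
Proof.
move=> Ew; set v := code_tm C in Ew *.
have Hv : size (rev v) <= w.
  by rewrite Ew; apply: size_le_stack; apply: leq_trans B2.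
exists (upd (upd (upd (upd (upd (upd (upd (loaded n w) rW1 0) rA w.*2) rW3 0) rW2 0) rW4 0)
  rX (stack B (symbols (code_tm (C ++ writer w))) 0)) rX (stack B (symbols (code_tm (C ++ writer w))) 0)).
split=> //.
rewrite /self_code (semThen copy_inputs) sem_copy_inputs (semThen push_writer) sem_push_writer //.
rewrite (semThen unreverse) (sem_unreverse (v := rev v) (x := stack B (symbols (code_table (writer w))) 0)) //.
rewrite (sem_push_size (w := w) (x := stack B (rev (symbols (rev v))) (stack B (symbols (code_table (writer w))) 0))) //.
have -> : stack B (symbols (code_tm (C ++ writer w))) 0 =
    stack B (symbols (nseq (3 * w + 3) true)) (stack B (rev (symbols (rev v)))
      (stack B (symbols (code_table (writer w))) 0)).
  rewrite code_tm_cat -/v size_writer; move: (code_table _) => y.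
  have -> : rev (symbols (rev v)) = symbols v by rewrite /symbols -map_rev revK.
  by rewrite !symbols_cat !stack_cat.
apply: functional_extensionality => r; rewrite /upd.
by case: (eqVneq r rX).
Qed.

(** * The decider's tape as two numerals in base [B] *)

Definition view (x : nat) (f : nat -> nat) : Prop := forall i, x %/ B ^ i %% B = f i.

Lemma view_push x d f : d < B -> view x f ->
  view (d + B * x) (fun i => if i is i'.+1 then f i' else d).
Proof.
move=> dB Hx; have B0 : 0 < B by apply: leq_trans B2.
have -> : d + B * x = x * B + d by rewrite addnC mulnC.
case=> [|i]; first by rewrite divn1 modnMDl modn_small.
by rewrite expnS divnMA divnMDl // (divn_small dB) addn0.
Qed.

Lemma view_pop x f : view x f -> x %% B = f 0 /\ view (x %/ B) (fun i => f i.+1).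
Proof. by move=> Hx; split=> [|i]; [rewrite -Hx divn1 | rewrite -Hx expnS divnMA]. Qed.

Lemma view_ext x f g : f =1 g -> view x f -> view x g.
Proof. by move=> fg Hx i; rewrite Hx. Qed.

Lemma view_stack s : all (fun d => d < B) s -> view (stack B s 0) (nth 0 s).
Proof.
elim: s => [_ i|d s IHs /= /andP[dB /IHs Hs]]; first by rewrite div0n mod0n nth_nil.
by apply: view_ext (view_push dB Hs) => -[].
Qed.

Variables (D : tm) (S : nat).
Hypothesis S0 : 0 < S.
Hypothesis D_bounded : forall q s i, lookup D q s = Some i -> s_write i < B /\ q_dst i < S.

Definition tape_bounded (c : config) := c_state c < S /\ forall z, c_tape c z < B.

Definition sim (e : env) (c : config) : Prop :=
  [/\ e rS = c_state c, e rC = c_tape c (c_head c),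
      view (e rL) (fun i => c_tape c (c_head c - 1 - i%:Z)%R),
      view (e rX) (fun i => c_tape c (c_head c + 1 + i%:Z)%R) & e rT = 0].

(** [dispatch] has cleared [rS] and [rC] before the action starts, so a halted configuration must be
    written back; it then stays put, as in [run]. *)
Definition action (q s : nat) : cmd :=
  if lookup D q s is Some i then
    Then (incs rS (q_dst i))
      match q_move i with
      | MLeft => Then (push B rX rT (s_write i)) (pop B rL rT rC)
      | MStay => incs rC (s_write i)
      | MRight => Then (push B rL rT (s_write i)) (pop B rX rT rC)
      end
  else Then (incs rS q) (incs rC s).

Definition dispatch (f : nat -> nat -> cmd) : cmd :=
  switch rS [seq switch rC [seq f q s | s <- iota 0 B] | q <- iota 0 S].

Lemma sem_dispatch f e : e rS < S -> e rC < B ->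
  sem (dispatch f) e = sem (f (e rS) (e rC)) (upd (upd e rS 0) rC 0).
Proof.
move=> HS HC; rewrite /dispatch sem_switch ?size_map ?size_iota //.
rewrite (nth_map 0) ?size_iota // nth_iota // add0n.
rewrite sem_switch ?size_map ?size_iota // (_ : upd e rS 0 rC = e rC) //.
by rewrite (nth_map 0) ?size_iota // nth_iota // add0n.
Qed.

Lemma step_bounded c : tape_bounded c -> tape_bounded (odflt c (step D c)).
Proof.
case: c => q h t Hc; rewrite /step /=; case El: (lookup _ _ _) => [i|] //=.
have [Hw Hq] := D_bounded El; split=> //= z; case: ifP => // _; exact: Hc.2.
Qed.

Lemma sim_step e c : tape_bounded c -> sim e c ->
  sim (sem (dispatch action) e) (odflt c (step D c)).
Proof.
case: c => q h t [Hq Ht] [/= ES EC EL EX ET]; rewrite /= in Hq Ht.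
rewrite sem_dispatch ?ES ?EC // /action.
case El: (lookup D q (t h)) => [i|]; last first.
  rewrite (_ : step _ _ = None); last by rewrite /step /= El.
  by rewrite semThen !sem_incs; split.
rewrite (_ : step _ _ = Some (Config (q_dst i) (shift (q_move i) h) (put t h (s_write i)))); last first.
  by rewrite /step /= El.
rewrite [odflt _ _]/=.
have [Hw Hqd] := D_bounded El.
rewrite semThen sem_incs; set e1 := upd (upd _ rC 0) rS _.
have E1 : [/\ e1 rS = q_dst i, e1 rC = 0, e1 rL = e rL, e1 rX = e rX & e1 rT = 0].
  by split=> //; rewrite /e1 /= ?upd_eq.
case: E1; move: e1 => e1 ES1 EC1 EL1 EX1 ET1.
rewrite /put; case: (q_move i).
- rewrite (semThen (push _ _ _ _)) sem_push // sem_pop //.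
  set x := _ + _; rewrite (_ : upd e1 rX x rL = e rL) //.
  have [H0 HL] := view_pop EL.
  split=> /=; rewrite ?ES1 ?ET1 //.
  + rewrite upd_eq H0 subr0; case: eqP => //; lia.
  + apply: view_ext HL => j; case: eqP => [|_]; first by lia.
    by congr t; lia.
  + rewrite /x EX1; apply: view_ext (view_push Hw EX) => -[|j].
      by rewrite addr0 subrK eqxx.
    by case: eqP => [|_]; [lia | congr t; lia].
- have EL2 v : upd e1 rC v rL = e rL by [].
  have EX2 v : upd e1 rC v rX = e rX by [].
  rewrite sem_incs; split=> /=; rewrite ?EL2 ?EX2 //.
  + by rewrite upd_eq EC1 eqxx.
  + by apply: view_ext EL => j; case: eqP => // Ej; lia.
  + by apply: view_ext EX => j; case: eqP => // Ej; lia.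
- rewrite (semThen (push _ _ _ _)) sem_push // sem_pop //.
  set x := _ + _; rewrite (_ : upd e1 rL x rX = e rX) //.
  have [H0 HX] := view_pop EX.
  split=> /=; rewrite ?ES1 ?ET1 //.
  + rewrite upd_eq H0 addr0; case: eqP => //; lia.
  + rewrite /x EL1; apply: view_ext (view_push Hw EL) => -[|j].
      by rewrite subr0 addrK eqxx.
    by case: eqP => [|_]; [lia | congr t; lia].
  + apply: view_ext HX => j; case: eqP => [|_]; first by lia.
    by congr t; lia.
Qed.
Lemma sim_upd e c r v : r \notin [:: rS; rC; rL; rX; rT] -> sim e c -> sim (upd e r v) c.
Proof.
rewrite !inE !negb_or => /and5P[rS' rC' rL' rX' rT'] [ES EC EL EX ET].
by split; rewrite upd_neq // eq_sym.
Qed.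

Lemma sim_init e v : e rX = stack B (symbols v) 0 ->
  e rT = 0 -> e rC = 0 -> e rL = 0 -> e rS = 0 ->
  sim (sem (pop B rX rT rC) e) (init v).
Proof.
move=> EX ET EC EL ES; rewrite sem_pop // EX.
have Hv : all (fun d => d < B) (symbols v).
  by rewrite all_map; apply/allP => -[] _ /=; apply: leq_trans B2.
have [H0 HX] := view_pop (view_stack Hv).
split=> // i.
by rewrite [upd _ _ _ _](_ : _ = 0) // div0n mod0n; case: i.
Qed.

Lemma init_bounded v : tape_bounded (init v).
Proof.
split=> //= -[] z; last by apply: leq_trans B2.
have [lt_z|le_z] := ltnP z (size v); last first.
  by rewrite nth_default ?size_map //; apply: leq_trans B2.
by rewrite (nth_map false) //; case: nth; apply: leq_trans B2.
Qed.

Lemma run_bounded n c : tape_bounded c -> tape_bounded (run D n c).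
Proof. by move=> Hc; elim: n => // n IHn; rewrite runS; apply: step_bounded. Qed.

Definition simulate : cmd := For rN1 (dispatch action).

Lemma sem_simulate e c : tape_bounded c -> sim e c ->
  sim (sem simulate e) (run D (e rN1) c).
Proof.
move=> Hc He; pose P j e' := sim e' (run D j c).
apply: (@sem_for P) => // j e' _ He'; rewrite /P runS.
by apply: sim_step; [apply: run_bounded | apply: sim_upd].
Qed.

(** Symbol 1 is the letter [false]. Only the first letter is inspected, which suffices for a decider
    whose output has one letter. *)
Definition says_false (c : config) : bool :=
  ~~ step D c && (c_tape c (c_head c) == 1).

Definition record_answer : cmd :=
  dispatch (fun q s => if ~~ lookup D q s && (s == 1) then Inc rE else Skip).

Lemma sem_record_answer e c : tape_bounded c -> sim e c ->
  sem record_answer e = upd (upd (upd e rS 0) rC 0) rE (e rE + says_false c).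
Proof.
move=> [Hq Ht] [ES EC _ _ _]; rewrite /record_answer sem_dispatch ?ES ?EC //.
rewrite /says_false /step; case: (lookup _ _ _) => [i|] /=; last first.
  by case: eqP => _ /=; rewrite ?addn1 // addn0 [RHS]upd_id.
by rewrite addn0 [RHS]upd_id.
Qed.

(** * The clock producing the sparse exponents *)

Definition square : cmd :=
  Then (spread rt [:: rU; rT; rY]) (Then (spread rY [:: rt])
    (Then (For rU (Then (spread rT [:: rk; rY]) (spread rY [:: rT])))
      (spread rT [::]))).

Lemma sem_clear x e : sem (spread x [::]) e = upd e x 0.
Proof.
rewrite sem_spread //; apply: functional_extensionality => r.
by rewrite /upd addn0.
Qed.

Lemma sem_spread2 x a b e : x != a -> x != b -> a != b ->
  sem (spread x [:: a; b]) e =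
  upd (upd (upd e x 0) a (e a + e x)) b (e b + e x).
Proof.
move=> xa xb ab; rewrite sem_spread ?inE ?negb_or ?xa //.
apply: functional_extensionality => r; rewrite /upd /= ![_ == r]eq_sym.
case: (eqVneq r x) => [->|rx]; first by rewrite (negPf xa) (negPf xb).
case: (eqVneq r a) => [->|ra]; first by rewrite (negPf ab) mul1n.
by case: (eqVneq r b) => [->|rb]; rewrite ?mul1n ?mul0n ?addn0.
Qed.

Lemma sem_square e : e rU = 0 -> e rT = 0 -> e rY = 0 ->
  sem square e = upd e rk (e rk + e rt * e rt).
Proof.
move=> U0 T0 Y0; set t := e rt.
rewrite /square (semThen (spread rt _)) (semThen (spread rY _)) (semThen (For _ _)).
have -> : sem (spread rY [:: rt]) (sem (spread rt [:: rU; rT; rY]) e) =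
    upd (upd e rU t) rT t.
  rewrite sem_move // sem_spread //; apply: functional_extensionality => r.
  rewrite /upd /=; do 24?[case: r => [|r]; first by rewrite /= ?U0 ?T0 ?Y0 ?mul1n ?mul0n ?addn0 ?add0n].
  by rewrite /= mul0n addn0.
set c := Then _ _; set e1 := upd (upd e _ _) _ _.
have -> : sem (For rU c) e1 = upd (upd (upd e rU 0) rT t) rk (e rk + t * t).
  pose P j e' := e' = upd (upd (upd e rU (t - j)) rT t) rk (e rk + t * j).
  have := @sem_for P rU c e1; rewrite (_ : e1 rU = t) // /P subnn; apply.
    by rewrite subn0 muln0 addn0 [RHS]upd_id.
  move=> j e' Hj ->; rewrite /c semThen sem_spread2 // sem_move //.
  apply: functional_extensionality => r; rewrite /upd /=.
  do 24?[case: r => [|r]; first by rewrite /= ?Y0 ?mulnS; lia].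
  by [].
rewrite sem_clear; apply: functional_extensionality => r; rewrite /upd.
by do 24?[case: r => [|r]; first by rewrite /= ?U0 ?T0 ?Y0].
Qed.

Definition tick : cmd :=
  Then (Inc rt) (If rk (Then (Dec rk) (spread rf [::]))
    (Then square (Then (spread rf [::]) (Inc rf)))).

(** The components are the time, the remaining wait and whether the time is an exponent. An exponent
    [t] starts a wait of [t ^ 2] steps, so the next one is [t + t ^ 2 + 1]. *)
Definition clock_step (x : nat * nat * bool) : nat * nat * bool :=
  let: (t, k, _) := x in
  if 0 < k then (t.+1, k.-1, false) else (t.+1, t.+1 ^ 2, true).

Definition clock (n : nat) := iter n clock_step (0, 0, false).

Definition output : cmd := If rE Skip (If rN0 (If rf (Inc rO1) Skip) (Inc rO2)).

Lemma sem_ticks e :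
  all (fun r => e r == 0) [:: rT; rU; rY; rt; rk; rf] ->
  sem (For rN2 tick) e rf = (clock (e rN2)).2.
Proof.
case/and5P=> /eqP T0 /eqP U0 /eqP Y0 /eqP t0 /and3P[/eqP k0 /eqP f0 _].
pose P j e' := [/\ e' rt = (clock j).1.1, e' rk = (clock j).1.2,
  e' rf = (clock j).2 & [/\ e' rT = 0, e' rU = 0 & e' rY = 0]].
have [] // : P (e rN2) (sem (For rN2 tick) e).
apply: (@sem_for P); first by split.
move=> j e' _ [Et Ek Ef [ET EU EY]]; set e1 := upd e' rN2 _.
have {Et Ek Ef ET EU EY} : P j e1 by split=> //; split.
case; move: e1 => e1 Et Ek Ef [ET EU EY].
rewrite /P /clock iterS -/(clock j); case: (clock j) Et Ek Ef => -[t k] f Et Ek Ef.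
rewrite /tick (semThen (Inc rt)) semInc; set e2 := upd e1 rt _.
have Et2 : e2 rt = t.+1 by rewrite /e2 upd_eq Et.
have Ek2 : e2 rk = k by [].
have [ET2 EU2 EY2] : [/\ e2 rT = 0, e2 rU = 0 & e2 rY = 0] by [].
move: e2 Et2 Ek2 ET2 EU2 EY2 => e2 Et2 Ek2 ET2 EU2 EY2.
rewrite [sem _ _](_ : _ = if 0 < e2 rk then sem (Then (Dec rk) (spread rf [::])) e2
  else sem (Then square (Then (spread rf [::]) (Inc rf))) e2) // Ek2.
rewrite /clock_step; case: posnP => k0'.
  rewrite (semThen square) (semThen (spread _ _)) sem_square // sem_clear semInc Et2 Ek2 k0'.
  by split.
rewrite (semThen (Dec _)) sem_clear; split=> //.
by rewrite -[LHS]/(e2 rk).-1 Ek2.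
Qed.

Definition program : cmd :=
  Then self_code (Then (pop B rX rT rC) (Then simulate
    (Then record_answer (Then (For rN2 tick) output)))).

Lemma keeps_action r q s : r \notin [:: rS; rC; rL; rX; rT] -> keeps r (action q s).
Proof.
rewrite !inE !negb_or ![r == _]eq_sym => /and5P[rS' rC' rL' rX' rT'].
rewrite /action; case: (lookup _ _ _) => [i|].
  apply/andP; split; first exact: keeps_incs.
  by case: (q_move i); [ | exact: keeps_incs | ];
     apply/andP; split; [exact: keeps_push | exact: keeps_pop
                        | exact: keeps_push | exact: keeps_pop].
by apply/andP; split; apply: keeps_incs.
Qed.

Lemma wf_action q s : wf K (action q s).
Proof.
rewrite /action; case: (lookup _ _ _) => [i|].
  apply/andP; split; first exact: wf_incs.
  by case: (q_move i); [ | exact: wf_incs | ];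
     apply/andP; split; [exact: wf_push | exact: wf_pop
                        | exact: wf_push | exact: wf_pop].
by apply/andP; split; apply: wf_incs.
Qed.

Lemma keeps_dispatch r f : r != rS -> r != rC ->
  (forall q s, keeps r (f q s)) -> keeps r (dispatch f).
Proof.
rewrite ![r == _]eq_sym => rS' rC' Hf; apply: keeps_switch => //.
rewrite all_map; apply/allP => q _ /=; apply: keeps_switch => //.
by rewrite all_map; apply/allP => s _ /=.
Qed.

Lemma wf_dispatch f : (forall q s, wf K (f q s)) -> wf K (dispatch f).
Proof.
move=> Hf; apply: wf_switch => //; rewrite all_map; apply/allP => q _ /=.
by apply: wf_switch => //; rewrite all_map; apply/allP => s _ /=.
Qed.

Lemma wf_push_seg v : wf K (push_seg v).
Proof. by apply/andP; split; [apply: wf_push_word | apply: wf_push_ones]. Qed.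

Lemma wf_program : wf K program.
Proof.
have wfT c d : wf K c -> wf K d -> wf K (Then c d) by move=> /= -> ->.
have keepsT r c d : keeps r c -> keeps r d -> keeps r (Then c d) by move=> /= -> ->.
have wfF r c : 0 < r < K -> keeps r c -> wf K c -> wf K (For r c).
  by move=> r0 kc wc; apply/and3P.
have Hseg := wf_push_seg.
have Kseg v : keeps rW1 (push_seg v).
  by apply: (keepsT); [apply: keeps_push_word | apply: keeps_push_ones].
have Kstep s : keeps rW1 (push_step s) by apply: (keepsT).
have Wstep s : wf K (push_step s) by apply: (wfT).
have K3 : keeps rW4 push3 by apply: keeps_push_word.
have W3 : wf K push3 by apply: wf_push_word.
apply: (wfT); first apply: (wfT) => //; first apply: (wfT); first apply: (wfT).
- apply: (wfF) => //; last by do 3?[apply: (wfT) => //].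
  by do 3?[apply: (keepsT) => //].
- by do 2?[apply: (wfT) => //].
- apply: (wfT); last by apply: (wfT) => //; apply: (wfF).
  apply: (wfF) => //; first apply: (keepsT); first exact: keeps_pop.
  + by apply: keeps_switch => //; apply/and4P; split=> //; apply: keeps_push.
  + apply: (wfT); first exact: wf_pop.
    by apply: wf_switch => //; apply/and4P; split=> //; apply: wf_push.
apply: (wfT); first exact: wf_pop.
apply: (wfT); last apply: (wfT) => //.
  apply: (wfF) => //; last by apply: wf_dispatch => q s; apply: wf_action.
  by apply: keeps_dispatch => // q s; apply: keeps_action.
by apply: wf_dispatch => q s; case: ifP.
Qed.

Lemma sem_program (C : tm) n w :
  w = stack B (symbols (rev (code_tm C))) 0 ->
  let e := sem program (input_env n w) in
  let c := run D n (init (code_tm (C ++ writer w))) in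
  (0 < e rO2) = ~~ says_false c && (n == 0) /\
  (0 < e rO1) = [&& ~~ says_false c, 0 < n & (clock n).2].
Proof.
move=> Ew e c; have [e1 [E1 EX [EN1 EN2 EN0] Hz]] := sem_self_code n Ew.
rewrite /e /program (semThen self_code) E1.
have z r : r \in [:: rT; rU; rC; rL; rS; rE; rt; rk; rf; rO1; rO2; rY] -> e1 r = 0.
  by move/(allP Hz)/eqP.
rewrite (semThen (pop _ _ _ _)) (semThen simulate) (semThen record_answer) (semThen (For _ _)).
set e2 := sem (pop _ _ _ _) e1.
have H2 : sim e2 (init (code_tm (C ++ writer w))) by apply: sim_init; rewrite ?EX ?z.
have K2 r : r \notin [:: rS; rC; rL; rX; rT] -> e2 r = e1 r.
  rewrite !inE !negb_or ![r == _]eq_sym => /and5P[rS' rC' rL' rX' rT'].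
  by apply: keepsP; apply: keeps_pop.
set e3 := sem simulate e2.
have H3 : sim e3 c by rewrite /c -EN1 -(K2 rN1) //; apply: sem_simulate => //; apply: init_bounded.
have K3 r : r \notin [:: rS; rC; rL; rX; rT; rN1] -> e3 r = e1 r.
  rewrite -[[:: rS; rC; rL; rX; rT; rN1]]/([:: rS; rC; rL; rX; rT] ++ [:: rN1]).
  rewrite mem_cat negb_or mem_seq1 => /andP[Hr rN1']; rewrite -(K2 r Hr); apply: keepsP.
  apply/andP; split; first by rewrite eq_sym.
  by apply: keeps_dispatch => [||q s]; last exact: keeps_action;
     apply: contra Hr => /eqP->.
rewrite (sem_record_answer (run_bounded n (init_bounded _)) H3) -/c.
set e4 := upd _ rE _.
have E4 : e4 rE = says_false c by rewrite /e4 upd_eq K3 // z.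
have T4 : e4 rT = 0 by case: H3.
have K4 r : r \notin [:: rS; rC; rL; rX; rT; rN1; rE] -> e4 r = e1 r.
  rewrite !inE !negb_or => /and5P[rS' rC' rL' rX' /and3P[rT' rN1' rE']].
  rewrite -(K3 r) ?inE ?negb_or ?rS' ?rC' ?rL' ?rX' ?rT' //.
  by rewrite /e4 /upd (negPf rS') (negPf rC') (negPf rE').
set e5 := sem (For rN2 tick) e4.
have F5 : e5 rf = (clock n).2.
  by rewrite /e5 sem_ticks ?K4 ?EN2 //= T4 !K4 // !z.
have K5 r : keeps r (For rN2 tick) -> e5 r = e4 r by apply: keepsP.
have -> : sem output e5 = if 0 < e5 rE then e5 else if 0 < e5 rN0 then
    if 0 < e5 rf then upd e5 rO1 (e5 rO1).+1 else e5 else upd e5 rO2 (e5 rO2).+1 by [].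
rewrite (K5 rE) // (K5 rN0) // E4 F5 (K4 rN0) // EN0.
have O1 : e5 rO1 = 0 by rewrite K5 // K4 // z.
have O2 : e5 rO2 = 0 by rewrite K5 // K4 // z.
case: (says_false c) => /=; first by rewrite O1 O2.
case: (posnP n) => n0 /=; first by rewrite /upd /= ?O1 ?O2 ?n0.
case: (clock n).2; last by rewrite /= O1 O2.
by rewrite /upd /= O2.
Qed.
End Program.

(** The table [C] works for all constants [w] at once, so [w] may then be taken to encode [C]. The
    bounds [B] and [S] exceed the input symbols and all that [D] can write or enter, so the dispatch
    tables cover every configuration that occurs. *)
Theorem diagonal_machine (D : tm) (v0 v1 v2 : word) : exists M : tm, forall n,
  outputs M (code_nat n)
    (if says_false D (run D n (init (code_tm M))) then v0
     else if n == 0 then v2 else if (clock n).2 then v1 else v0).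
Proof.
pose B := (\max_(i <- D) s_write i).+3; pose S := (\max_(i <- D) q_dst i).+1.
have DB q s i : lookup D q s = Some i -> s_write i < B /\ q_dst i < S.
  rewrite /lookup /B /S => Hi; have : List.In i D.
    elim: (D) Hi => //= j D' IHD; case: ifP => _ /=; first by case=> ->; left.
    by move/IHD; right.
  elim: (D) => //= j D' IHD [->|/IHD]; rewrite !big_cons; lia.
have B2 : 2 < B by [].
have Hwf : wf K (program B D S) by apply: wf_program.
have [C HC] : exists C, forall w n, let e := sem (program B D S) (input_env n w) in
    outputs (C ++ writer w) (code_nat n)
      (if 0 < e rO2 then v2 else if 0 < e rO1 then v1 else v0).
  exists (machine K (program B D S) rO1 rO2 v0 v1 v2) => w n.
  exact: machine_correct.
pose w := stack B (symbols (rev (code_tm C))) 0.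
exists (C ++ writer w) => n; have := HC w n.
have := sem_program B2 (ltn0Sn _ : 0 < S) DB n (erefl w).
cbv zeta; case=> -> ->.
by case: (says_false _ _) => //; case: (posnP n) => [->|n0].
Qed.

(** * Normal forms modulo an ideal *)

Local Open Scope ring_scope.

(** Induction on the number of coordinates in which members may differ. Fix a member [m0]: one not
    above it has a free coordinate [i] with value below [m0 i], so it lies in one of finitely many
    slices, each with one free coordinate fewer. *)
Lemma dickson (k : nat) (P : 'X_{1..k} -> Prop) : exists s : seq 'X_{1..k},
  (forall m, m \in s -> P m) /\
  (forall m, P m -> exists2 m', m' \in s & (m' <= m)%MM).
Proof.
suff H j (J : {set 'I_k}) (Q : 'X_{1..k} -> Prop) : #|J| = j ->
    (forall m m', Q m -> Q m' -> forall i, i \notin J -> m i = m' i) ->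
    exists s : seq 'X_{1..k}, (forall m, m \in s -> Q m) /\
      (forall m, Q m -> exists2 m', m' \in s & (m' <= m)%MM).
  by apply: (H _ setT P erefl) => m m' _ _ i; rewrite in_setT.
elim: j J Q => [|j IHj] J Q cardJ HQ; (have [[m0 Qm0]|noQ] := classic (exists m, Q m);
    last by exists [::]; split=> // m Qm; case: noQ; exists m).
  exists [:: m0]; split=> [m|m Qm]; first by rewrite inE => /eqP->.
  exists m0; rewrite ?inE //; apply/mnm_lepP => i; rewrite (HQ m0 m) //.
  by move: cardJ => /eqP; rewrite cards_eq0 => /eqP->; rewrite in_set0.
have Hx (x : 'I_k * nat) : exists s : seq 'X_{1..k}, x.1 \in J ->
    (forall m, m \in s -> Q m) /\
    (forall m, Q m -> m x.1 = x.2 -> exists2 m', m' \in s & (m' <= m)%MM).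
  case: x => i v /=; have [iJ|] := boolP (i \in J); last by exists [::].
  have [||s [Hs1 Hs2]] := IHj (J :\ i) (fun m => Q m /\ m i = v).
  - by move: cardJ; rewrite (cardsD1 i) iJ => -[].
  - move=> m m' [Qm mi] [Qm' mi'] i'; rewrite !inE negb_and negbK.
    by case/orP=> [/eqP->|]; [rewrite mi mi' | apply: HQ].
  exists s => _; split=> [m /Hs1[]//|m Qm mi]; exact: Hs2.
have [f Hf] := functional_choice _ Hx.
exists (m0 :: flatten [seq flatten [seq f (i, v) | v <- iota 0 (m0 i)] | i <- enum J]).
split=> [m|m Qm].
  rewrite inE => /predU1P[->//|/flattenP[s /mapP[i iJ ->]]].
  case/flattenP=> s' /mapP[v _ ->]; move: iJ; rewrite mem_enum => iJ.
  by have [H _] := Hf (i, v) iJ => /H.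
have [le_m0m|] := boolP (m0 <= m)%MM; first by exists m0; rewrite ?mem_head.
move/mnm_lepP => /not_all_ex_not[i /negP]; rewrite -ltnNge => lt_i.
have iJ : i \in J by apply: contraLR lt_i => iJ; rewrite (HQ m0 m) // ltnn.
have [_ /(_ m Qm erefl)[m' m's le_m'm]] := Hf (i, m i) iJ.
exists m' => //; rewrite inE; apply/orP; right; apply/flattenP.
exists (flatten [seq f (i, v) | v <- iota 0 (m0 i)]).
  by apply/mapP; exists i; rewrite ?mem_enum.
apply/flattenP; exists (f (i, m i)) => //; apply/mapP; exists (m i) => //.
by rewrite mem_iota.
Qed.

Section NormalForm.
Variables (A : idomainType) (k : nat) (I : {mpoly A[k]} -> Prop).
Hypotheses (I_zero : I 0) (I_add : forall x y, I x -> I y -> I (x + y))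
  (I_mul : forall x y, I x -> I (y * x)) (I_const : forall a, I a%:MP -> a = 0).

Lemma cancel_lead (p q : {mpoly A[k]}) : mlead q = mlead p -> mleadc q = mleadc p ->
  p - q = 0 \/ (mlead (p - q)%R < mlead p)%O.
Proof.
move=> Em Ec; have [->|nz] := eqVneq (p - q) 0; [by left | right].
rewrite lt_neqAle (le_trans (mleadB_le _ _)) ?Em ?joinxx // andbT.
apply: contraTneq (mlead_supp nz) => ->.
by rewrite mcoeff_msupp mcoeffB -{2}Em Ec subrr eqxx.
Qed.

(* A Groebner basis of the ideal [I] over the fraction field of [A]: clearing
   denominators only involves powers of [c], the product of the leading
   coefficients of the basis. *)
Lemma normal_form : exists c : A, c != 0 /\ exists std : {mpoly A[k]} -> Prop,
  [/\ forall p q, std p -> std q -> std (p + q), forall a p, std p -> std (a *: p),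
      forall p, std p -> I p -> p = 0, std 1 &
      forall h, exists e r, std r /\ I (c ^+ e *: h - r)].
Proof.
pose lead m := exists g, [/\ I g, g != 0 & mlead g = m].
pose std (p : {mpoly A[k]}) := forall m, m \in msupp p -> ~ lead m.
have I_scale a x : I x -> I (a *: x) by rewrite -mul_mpolyC; apply: I_mul.
have std_add p q : std p -> std q -> std (p + q).
  by move=> Hp Hq m /msuppD_le; rewrite mem_cat => /orP[/Hp|/Hq].
have std_scale a p : std p -> std (a *: p) by move=> Hp m /msuppZ_le/Hp.
have std_I p : std p -> I p -> p = 0.
  move=> Hp Ip; apply/eqP; apply/negPn/negP => nz.
  by apply: (Hp _ (mlead_supp nz)); exists p.
have [s [Hs1 Hs2]] := dickson lead.
have Hg m : exists g, lead m -> [/\ I g, g != 0 & mlead g = m].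
  by have [[g Hg]|] := classic (lead m); [exists g | exists 0].
have [G HG] := functional_choice _ Hg.
pose c := \prod_(m <- s) mleadc (G m).
have c0 : c != 0.
  rewrite /c prodf_seq_neq0; apply/allP => m /Hs1/HG[_ nz _] /=.
  by rewrite mleadc_eq0.
exists c; split=> //; exists std; split=> //.
  (* A nonzero element of [I] led by the least monomial is a constant, which [I_const] forbids. *)
  move=> m; rewrite msupp1 inE => /eqP-> [g [Ig nz Em]].
  have Eg : g = (g@_0%MM)%:MP.
    apply/mpolyP => m'; rewrite mcoeffC; case: (eqVneq m' 0%MM) => [->|nz'].
      by rewrite mulr1.
    rewrite mulr0; apply: mcoeff_gt_mlead; rewrite Em lt_neqAle eq_sym nz'.
    by apply: lem_leo; apply/mnm_lepP => i; rewrite mnmE.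
  have Eg0 : g@_0%MM = 0 by apply: I_const; rewrite -Eg.
  by move: nz; rewrite Eg Eg0 mpolyC0 eqxx.
elim/mleadrect=> p IHp.
have IHp' q : q = 0 \/ (mlead q < mlead p)%O ->
    exists e r, std r /\ I (c ^+ e *: q - r).
  case=> [->|/IHp//]; exists 0%N, 0; split; last by rewrite scaler0 subr0.
  by move=> m; rewrite msupp0.
have [->|nz_p] := eqVneq p 0; first by apply: IHp'; left.
have [/Hs2[m ms le_m]|not_lead] := classic (lead (mlead p)).
  have [Ig nz Em] := HG m (Hs1 m ms).
  have [c' Ec] : exists c', c = c' * mleadc (G m).
    by exists (\prod_(m' <- rem m s) mleadc (G m')); rewrite /c (big_rem m ms) mulrC.
  have c'0 : c' != 0 by apply: contraNneq c0 => c'0; rewrite Ec c'0 mul0r.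
  (* Scaling [p] by [c = c' * mleadc (G m)] makes its leading term a multiple of that of [G m]
     without division, at the price of one more power of [c]. *)
  pose q := (c' * mleadc p) *: (G m * 'X_[(mlead p - m)%MM]).
  have Iq : I q by apply: I_scale; rewrite mulrC; apply: I_mul.
  have Elm : mlead q = mlead (c *: p).
    rewrite !mleadZ ?mulf_neq0 ?mleadc_eq0 // mleadM ?mleadXm ?Em; last first.
    - by rewrite -mleadc_eq0 mleadXm mcoeffX eqxx oner_eq0.
    - by [].
    by rewrite addmC submK.
  have [e [r [Hr HI]]] : exists e r, std r /\ I (c ^+ e *: (c *: p - q) - r).
    apply: IHp'; rewrite -(mleadZ (c := c) p) //.
    apply: cancel_lead => //.
    have Eq : (G m * 'X_[(mlead p - m)%MM])@_(mlead p) = mleadc (G m).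
      by rewrite -[X in _@_X = _](submK le_m) mcoeffMX Em.
    by rewrite Elm mleadZ // !mcoeffZ Eq Ec; ring.
  exists e.+1, r; split=> //.
  have -> : c ^+ e.+1 *: p - r = (c ^+ e *: (c *: p - q) - r) + c ^+ e *: q.
    by rewrite scalerBr scalerA exprSr; ring.
  by apply: I_add => //; apply: I_scale.
(* Here the leading monomial is standard: its term goes to the remainder, scaled by whatever power
   of [c] the rest needs. *)
pose q := mleadc p *: 'X_[mlead p].
have [e [r [Hr HI]]] : exists e r, std r /\ I (c ^+ e *: (p - q) - r).
  apply: IHp'; apply: cancel_lead; rewrite /q ?mleadZ ?mleadc_eq0 ?mleadXm //.
  by rewrite mcoeffZ mcoeffX eqxx mulr1.
exists e, (r + c ^+ e *: q); split.
  apply: std_add => //; do 2!apply: (std_scale); move=> m.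
  by rewrite msuppX inE => /eqP->.
by move: HI; rewrite scalerBr opprD addrA; congr I; ring.
Qed.

End NormalForm.

(** * A sparse power series with a transcendental root *)

Definition divides (R : pzRingType) (x y : R) := exists z, y = x * z.

Section Divides.
Variable R : comPzRingType.
Implicit Types x y z : R.

Lemma dividesD x y z : divides x y -> divides x z -> divides x (y + z).
Proof. by case=> a -> [b ->]; exists (a + b); rewrite mulrDr. Qed.

Lemma dividesMr x y z : divides x y -> divides x (y * z).
Proof. by case=> a ->; exists (a * z); rewrite mulrA. Qed.

Lemma dividesMl x y z : divides x y -> divides x (z * y).
Proof. by rewrite mulrC; apply: dividesMr. Qed.

Lemma dividesB x y z : divides x y -> divides x z -> divides x (y - z).
Proof. by case=> a -> [b ->]; exists (a - b); rewrite mulrBr. Qed.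

Lemma divides0 x : divides x 0.
Proof. by exists 0; rewrite mulr0. Qed.

Lemma divides_sum x (I : finType) (F : I -> R) :
  (forall i, divides x (F i)) -> divides x (\sum_i F i).
Proof.
move=> HF; elim/big_ind: _ => [|y z|i _]; [exact: divides0 | exact: dividesD | exact: HF].
Qed.

Lemma divides_exp x m n : (m <= n)%N -> divides (x ^+ m) (x ^+ n).
Proof. by move/subnKC <-; rewrite exprD; eexists. Qed.

Lemma divides_expM x y n : divides x y -> divides (x ^+ n) (y ^+ n).
Proof. by case=> a ->; rewrite exprMn; eexists. Qed.

Lemma divides_trans x y z : divides x y -> divides y z -> divides x z.
Proof. by case=> a -> [b ->]; exists (a * b); rewrite mulrA. Qed.
End Divides.

(** Two consecutive gaps around one isolated exponent [b] are demanded: the truncations on both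
    sides of [b] will be killed, and they differ by the monomial of degree [b]. The factor [C] is
    arbitrary, as it will depend on the polynomial to be refuted. *)
Definition wide_gaps (fl : nat -> bool) := forall C, exists a b c : nat, [/\ (0 < a < b)%N,
  (C * a.+1 < b)%N, (C * b.+1 < c)%N, fl b &
  forall i, (a < i < c)%N -> i != b -> ~~ fl i].

(* Satisfied by the absolute value of an integer, and by [2 ^ deg p] for a
   polynomial [p] over a finite field. *)
Record euclidean_size (A : idomainType) (s : A -> nat) : Prop := EuclideanSize {
  size_eq0 : forall x, (s x == 0%N) = (x == 0);
  sizeM : forall x y, s (x * y) = (s x * s y)%N;
  sizeD : forall x y, (s (x + y)%R <= s x + s y)%N;
  size_div : forall x y, y != 0 -> exists z, (s (x - z * y)%R < s y)%N;
  size_large : exists x, (3 < s x)%N }.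

Section Euclidean.
Variables (A : idomainType) (s : A -> nat).
Hypothesis Hs : euclidean_size s.
Implicit Types x y z q c : A.

Lemma size0 : s 0 = 0%N.
Proof. by apply/eqP; rewrite (size_eq0 Hs). Qed.

Lemma size_gt0 x : x != 0 -> (0 < s x)%N.
Proof. by rewrite lt0n (size_eq0 Hs). Qed.

Lemma size1 : s 1 = 1%N.
Proof.
have := sizeM Hs 1 1; have := size_gt0 (oner_neq0 A); rewrite mulr1; move: (s 1) => n; nia.
Qed.

Lemma sizeN x : s (- x) = s x.
Proof.
have H1 : s (- 1) = 1%N.
  by have := sizeM Hs (- 1) (- 1); rewrite mulrNN mulr1 size1; move: (s _) => n; nia.
by rewrite -mulN1r (sizeM Hs) H1 mul1n.
Qed.

Lemma sizeX x n : s (x ^+ n) = (s x ^ n)%N.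
Proof. by elim: n => [|n IHn]; rewrite ?expr0 ?size1 // exprS expnS (sizeM Hs) IHn. Qed.

Lemma size_prod (I : finType) (F : I -> A) : s (\prod_i F i) = (\prod_i s (F i))%N.
Proof. by elim/big_rec2: _ => [|i a x _ <-]; rewrite ?size1 ?(sizeM Hs). Qed.

Lemma size_sum (I : finType) (P : pred I) (F : I -> A) :
  (s (\sum_(i | P i) F i)%R <= \sum_(i | P i) s (F i))%N.
Proof.
elim/big_rec2: _ => [|i a x _ IH]; rewrite ?size0 //.
by apply: leq_trans (sizeD Hs _ _) _; rewrite leq_add2l.
Qed.

Lemma size1_unit x : s x = 1%N -> divides x 1.
Proof.
move=> sx; have x0 : x != 0 by rewrite -(size_eq0 Hs) sx.
have [z] := size_div Hs 1 x0; rewrite sx ltnS leqn0 (size_eq0 Hs) subr_eq0.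
by move/eqP=> E; exists z; rewrite mulrC.
Qed.

Lemma size_divides x y : y != 0 -> divides x y -> (s x <= s y)%N.
Proof.
move=> y0 [z E]; have := size_gt0 y0; rewrite E (sizeM Hs); case: (s z) => [|n].
  by rewrite muln0.
by rewrite leq_pmulr.
Qed.

Definition prime_elt q := (1 < s q)%N /\
  forall x y, divides q (x * y) -> divides q x \/ divides q y.

Lemma divides_prime_exp q x n : prime_elt q -> divides q (x ^+ n) -> divides q x.
Proof.
case=> q1 qP; elim: n => [|n IHn]; last by rewrite exprS => /qP[|/IHn].
rewrite expr0 => H; have := size_divides (oner_neq0 A) H; rewrite size1; lia.
Qed.

Lemma ex_min_size (P : A -> Prop) : (exists x, P x) ->
  exists x, P x /\ forall y, P y -> (s x <= s y)%N.
Proof.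
case=> x; move: {2}(s x) (leqnn (s x)) => n; elim: n x => [|n IHn] x Hx Px.
  by exists x; split=> // y _; apply: leq_trans Hx _.
have [[y [Py lt_y]]|N] := classic (exists y, P y /\ (s y < s x)%N).
  by apply: (IHn y) => //; rewrite -ltnS; apply: leq_trans Hx.
by exists x; split=> // y Py; rewrite leqNgt; apply/negP => lt_y; case: N; exists y.
Qed.

(** Bezout: an element [g] of least size in the ideal generated by [q] and [x] divides both. It is a
    unit, or it is associated to [q], which then divides [x]. *)
Lemma irreducible_prime q : (1 < s q)%N ->
  (forall x, divides x q -> (1 < s x)%N -> (s q <= s x)%N) -> prime_elt q.
Proof.
move=> q1 Hq; split=> // x y qxy; have [qx|nqx] := classic (divides q x); [by left | right].
have q0 : q != 0 by apply: contraTneq q1 => ->; rewrite size0.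
pose P g := g != 0 /\ exists a b, g = a * q + b * x.
have [|g [[g0 [a [b Eg]]] Hg]] := @ex_min_size P.
  by exists q; split=> //; exists 1, 0; rewrite mul0r addr0 mul1r.
have gdiv z : (exists a b, z = a * q + b * x) -> divides g z.
  case=> a' [b' Ez]; have [w Hw] := size_div Hs z g0; exists w; apply/eqP.
  rewrite mulrC -subr_eq0; apply/negPn/negP => nz; move: Hw; rewrite ltnNge => /negP[].
  apply: Hg; split=> //; exists (a' - w * a), (b' - w * b); rewrite Ez Eg; ring.
have gq : divides g q by apply: gdiv; exists 1, 0; rewrite mul0r addr0 mul1r.
have gx : divides g x by apply: gdiv; exists 0, 1; rewrite mul0r add0r mul1r.
have [g1|g1] := leqP (s g) 1; last first.
  case: nqx; case: gq (Hq _ gq g1) => k Ek; rewrite {1}Ek (sizeM Hs) => le_gk.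
  have sk : s k = 1%N.
    have := size_gt0 q0; rewrite Ek (sizeM Hs); move: le_gk g1; case: (s k) => [|[|n]] //; nia.
  have [k' Ek'] := size1_unit sk; apply: divides_trans gx; exists k'.
  by rewrite Ek -mulrA -Ek' mulr1.
have sg : s g = 1%N by have := size_gt0 g0; lia.
have [g' Eg'] := size1_unit sg.
have -> : y = g' * (a * y * q + b * (x * y)).
  by rewrite -[LHS]mul1r Eg' Eg; ring.
apply: dividesMl; apply: dividesD; first by exists (a * y); rewrite mulrC.
exact: dividesMl.
Qed.

(** Euclid's argument: a least nontrivial divisor of [1 + c * y], where [y] is large enough to keep
    this from being a unit. *)
Lemma ex_prime_not_dividing c : c != 0 -> exists q, prime_elt q /\ ~ divides q c.
Proof.
move=> c0; have [y Hy] := size_large Hs; pose u := 1 + c * y.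
have Hu : (1 < s u)%N.
  have : (s (c * y)%R <= s u + s (- 1)%R)%N.
    have -> : c * y = u + (- 1) by rewrite /u; ring.
    exact: (sizeD Hs).
  by rewrite sizeN size1 (sizeM Hs); have := size_gt0 c0; nia.
have [|q [[qu q1] Hq]] := @ex_min_size (fun d => divides d u /\ (1 < s d)%N).
  by exists u; split=> //; exists 1; rewrite mulr1.
exists q; split.
  apply: irreducible_prime => // x xq x1; apply: Hq; split=> //.
  exact: divides_trans qu.
move=> qc; have q1' : divides q 1.
  by rewrite (_ : 1 = u - c * y); [apply: dividesB => //; apply: dividesMr | rewrite /u; ring].
by have := size_divides (oner_neq0 A) q1'; rewrite size1; lia.
Qed.

Section Prime.
Variable q : A.
Hypothesis q_prime : prime_elt q.

Lemma prime_neq0 : q != 0.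
Proof. by case: q_prime => q1 _; apply: contraTneq q1 => ->; rewrite size0. Qed.

Lemma prime_exp_not_divides x : x != 0 -> exists n, ~ divides (q ^+ n) x.
Proof.
move=> x0; exists (s x) => /(size_divides x0); rewrite sizeX.
case: q_prime => q1 _; have := ltn_expl (s x) q1; lia.
Qed.

Lemma prime_exp_split n x y : divides (q ^+ n) (x * y) ->
  exists i j, [/\ (i + j)%N = n, divides (q ^+ i) x & divides (q ^+ j) y].
Proof.
elim: n => [|n IHn] H.
  by exists 0%N, 0%N; rewrite expr0; split=> //; [exists x | exists y]; rewrite mul1r.
have [i [j [Eij [x' Ex] [y' Ey]]]] := IHn (divides_trans (divides_exp _ (leqnSn n)) H).
have : divides q (x' * y').
  case: H => z; rewrite Ex Ey exprSr -Eij exprD => Ez; exists z.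
  have qn0 : q ^+ i * q ^+ j != 0 by rewrite mulf_neq0 // expf_neq0 // prime_neq0.
  by apply: (mulfI qn0); rewrite [RHS]mulrA -Ez; ring.
case: q_prime => _ qP /qP[[x'' Ex']|[y'' Ey']].
  exists i.+1, j; split; rewrite ?Eij //; last by exists y'.
  - by rewrite addSn Eij.
  - by exists x''; rewrite Ex Ex' exprSr mulrA.
exists i, j.+1; split; rewrite ?addnS ?Eij //; first by exists x'.
by exists y''; rewrite Ey Ey' exprSr mulrA.
Qed.

Lemma prime_exp_cancel n c x : ~ divides q c -> divides (q ^+ n) (c * x) ->
  divides (q ^+ n) x.
Proof.
move=> qc /prime_exp_split[[|i] [j [<- Hc Hx]]]; first by rewrite add0n.
by case: qc; apply: divides_trans Hc; exists (q ^+ i); rewrite exprS.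
Qed.
End Prime.

(** In the Leibniz formula the sum over permutations is bounded by the sum over all maps, which
    factors into the row sums. *)
Lemma size_det n (M : 'M[A]_n) : (s (\det M) <= \prod_i \sum_j s (M i j))%N.
Proof.
apply: leq_trans (size_sum _ _) _.
have sgn (b : bool) x : s ((-1) ^+ b * x) = s x.
  by case: b; rewrite ?expr1 ?expr0 ?mul1r // mulN1r sizeN.
rewrite bigA_distr_bigA.
under eq_bigr => sg _ do rewrite sgn size_prod.
rewrite (_ : (\sum_(sg : 'S_n) _)%N = (\sum_(f in [set pval sg | sg : 'S_n]) \prod_i s (M i (f i)))%N).
  by rewrite big_mkcond /=; apply: leq_sum => f _; case: ifP.
rewrite big_imset /=; last by move=> sg1 sg2 _ _; apply: val_inj.
by apply: eq_big => [sg|sg _]; rewrite ?inE //; apply: eq_bigr => i _; rewrite pvalE.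
Qed.

Definition height (p : {poly A}) := (\sum_(i < size p) s p`_i)%N.

(** The rows of the Sylvester matrix are shifted coefficient lists of [p] and of [g], so each row
    sum is at most the corresponding height. *)
Lemma size_resultant (p g : {poly A}) :
  (s (resultant p g) <= height p ^ (size g).-1 * height g ^ (size p).-1)%N.
Proof.
pose a (r : {poly A}) i := s r`_i.
have row_sum (r : {poly A}) m k : (\sum_(j < m) s (r`_(j - k) *+ (k <= j))%R <= height r)%N.
  have sum_le u v : (u <= v)%N -> (\sum_(0 <= i < u) a r i <= \sum_(0 <= i < v) a r i)%N.
    by move=> le_uv; rewrite (big_cat_nat (leq0n u) le_uv) leq_addr.
  have sum_height u : (\sum_(0 <= i < u) a r i <= height r)%N.
    apply: leq_trans (sum_le _ _ (leq_maxl u (size r))) _.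
    rewrite (big_cat_nat (leq0n (size r)) (leq_maxr _ _)) /= big_mkord.
    rewrite [X in (_ + X)%N]big_nat_cond [X in (_ + X)%N]big1 ?addn0 // => i /andP[/andP[le_ri _] _].
    by rewrite /a nth_default // size0.
  apply: leq_trans (sum_height (m - k)%N).
  have [le_km|lt_mk] := leqP k m; last first.
    rewrite big1 // => j _; rewrite leqNgt (ltn_trans (ltn_ord j) lt_mk) mulr0n.
    exact: size0.
  rewrite -(big_mkord xpredT (fun j => s (r`_(j - k) *+ (k <= j)))).
  rewrite (big_cat_nat (leq0n k) le_km) /= big_nat_cond big1 ?add0n; last first.
    by move=> j /andP[/andP[_ lt_jk] _]; rewrite leqNgt lt_jk mulr0n size0.
  rewrite -{1}[k]add0n big_addn; apply: leq_sum => j _.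
  by rewrite leq_addl addnK mulr1n.
apply: leq_trans (size_det _) _; rewrite big_split_ord /=.
apply: leq_mul.
  rewrite -[X in (_ <= _ ^ X)%N]card_ord -prod_nat_const; apply: leq_prod => i _.
  apply: leq_trans (row_sum p ((size g).-1 + (size p).-1)%N i); apply: leq_sum => j _.
  by rewrite Sylvester_mxE (unsplitK (inl i)).
rewrite -[X in (_ <= _ ^ X)%N]card_ord -prod_nat_const; apply: leq_prod => i _.
apply: leq_trans (row_sum g ((size g).-1 + (size p).-1)%N i); apply: leq_sum => j _.
by rewrite Sylvester_mxE (unsplitK (inr i)).
Qed.

(** * The [q]-adic root of the sparse series has no annihilator *)

Section SparseSeries.
Variables (q : A) (fl : nat -> bool).
Hypotheses (q_prime : prime_elt q) (fl1 : fl 1%N).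
Hypothesis fl_gaps : wide_gaps fl.

Definition sparse_coef (n : nat) : A := if n == 0%N then q else (fl n)%:R.

Definition sparse (n : nat) : {poly A} := \poly_(i < n) sparse_coef i.

Lemma sparse_cut n N x : (n <= N)%N -> divides q x ->
  divides (q ^+ n) ((sparse N).[x] - (sparse n).[x]).
Proof.
move=> /subnKC <- qx; rewrite !horner_poly big_split_ord /= addrAC subrr add0r.
apply: divides_sum => i; apply: dividesMl.
exact: divides_trans (divides_exp _ (leq_addr _ _)) (divides_expM _ qx).
Qed.

Lemma dividesXX x y n : divides (x - y) (x ^+ n - y ^+ n).
Proof. by rewrite subrXX; eexists. Qed.

(** The linear coefficient is 1 and higher terms contribute multiples of [q], so the slope is 1
    modulo [q]. This is why the Newton iteration [approx] needs no division. *)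
Lemma sparse_increment N x y : divides q x -> divides q y ->
  exists t, (sparse N.+2).[x] - (sparse N.+2).[y] = (x - y) * (1 + q * t).
Proof.
move=> qx qy; rewrite !horner_poly -sumrB !big_ord_recl /= /sparse_coef /= fl1.
suff [t ->] : divides ((x - y) * q) (\sum_(i < N) ((fl (bump 0 (bump 0 i)))%:R * x ^+ bump 0 (bump 0 i) -
    (fl (bump 0 (bump 0 i)))%:R * y ^+ bump 0 (bump 0 i))).
  by exists t; rewrite !expr0 !expr1 mulr1n; ring.
apply: divides_sum => i; rewrite -mulrBr; apply: dividesMl; rewrite /bump /= !add1n.
have -> : x ^+ i.+2 - y ^+ i.+2 = x * (x ^+ i.+1 - y ^+ i.+1) + (x - y) * y ^+ i.+1.
  by rewrite !exprS; ring.
apply: dividesD; last first.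
  by case: qy => z Ez; exists (z * y ^+ i); rewrite exprS {2}Ez; ring.
by case: qx => z Ez; case: (dividesXX x y i.+1) => w ->; exists (z * w); rewrite {1}Ez; ring.
Qed.

(* The [q]-adic approximations of the root of the series
   [g = q + x + \sum_(i > 1 | fl i) x ^ i]. *)
Fixpoint approx (n : nat) : A :=
  if n is m.+1 then approx m - (sparse n).[approx m] else 0.

Lemma approxP n : divides q (approx n) /\ divides (q ^+ n) (sparse n).[approx n].
Proof.
elim: n => [|[|n] [IHq IHr]].
- by split; [exact: divides0 | exists (sparse 0).[0]; rewrite expr0 mul1r].
- rewrite /= !horner_poly !big_ord_recl !big_ord0 /sparse_coef /= !expr0 expr1.
  by split; [exists (- 1) | exists 1]; ring.
set x := approx n.+1 in IHq IHr *; set d := (sparse n.+2).[x].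
have Hd : divides (q ^+ n.+1) d.
  by rewrite -[d](subrK (sparse n.+1).[x]); apply: dividesD => //; apply: sparse_cut.
have qd : divides q d.
  by apply: divides_trans Hd; rewrite exprS; eexists.
have -> : approx n.+2 = x - d by [].
have qy : divides q (x - d) by apply: dividesB.
split=> //; have [t Et] := sparse_increment n qy IHq.
have -> : (sparse n.+2).[x - d] = d * (q * - t).
  by rewrite -/d in Et; rewrite -[LHS](subrK d) Et; ring.
case: Hd => z Ez; exists (z * - t); rewrite Ez (exprSr q n.+1); ring.
Qed.

Lemma sparse_approx n N : (n <= N)%N -> divides (q ^+ n) (sparse N).[approx n].
Proof.
move=> le_nN; have [Hq Hr] := approxP n.
by rewrite -[_.[_]](subrK (sparse n).[approx n]); apply: dividesD => //; apply: sparse_cut.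
Qed.

Lemma approx_cauchy n m : (n <= m)%N -> divides (q ^+ n) (approx m - approx n).
Proof.
move=> /subnKC <-; elim: (m - n)%N => [|k IHk]; first by rewrite addn0 subrr; apply: divides0.
have -> : approx (n + k.+1) - approx n =
    (approx (n + k) - approx n) - (sparse (n + k).+1).[approx (n + k)].
  by rewrite addnS /=; ring.
apply: dividesB => //; apply: divides_trans (divides_exp _ (leq_addr k n)) _.
exact: sparse_approx.
Qed.

(** This says that [P] vanishes at the [q]-adic root, without constructing the completion of [A]. *)
Definition annihilates (P : {poly A}) := forall n, divides (q ^+ n) P.[approx n].

Lemma horner_congr (P : {poly A}) x y : divides (x - y) (P.[x] - P.[y]).
Proof.
have /factor_theorem[Q EQ] : root (P - P.[y]%:P) y by rewrite rootE !hornerE subrr.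
by exists Q.[x]; have := congr1 (horner^~ x) EQ; rewrite !hornerE => ->; rewrite mulrC.
Qed.

(** The completion is a domain: if [P] fails at level [a], then at level [a + b] fewer than [a]
    factors [q] can come from [P], so at least [b] come from [Q]. *)
Lemma annihilatesM P Q : annihilates (P * Q) -> annihilates P \/ annihilates Q.
Proof.
move=> HPQ; have [|nP] := classic (annihilates P); [by left | right => b].
case/not_all_ex_not: nP => a nPa.
have le_congr (R : {poly A}) n m : (n <= m)%N -> divides (q ^+ n) R.[approx m] ->
    divides (q ^+ n) R.[approx n].
  move=> le_nm HR; rewrite -[R.[approx n]](subKr R.[approx m]); apply: dividesB => //.
  exact: divides_trans (approx_cauchy le_nm) (horner_congr _ _ _).
have := HPQ (a + b)%N; rewrite hornerM.
case/(prime_exp_split q_prime) => i [j [Eij Hi Hj]].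
have [le_ai|lt_ia] := leqP a i.
  case: nPa; apply: le_congr (leq_addr b a) _.
  exact: divides_trans (divides_exp _ le_ai) Hi.
apply: le_congr (leq_addl a b) _; apply: divides_trans (divides_exp _ _) Hj; lia.
Qed.

Lemma annihilates_mull P Q : annihilates P -> annihilates (Q * P).
Proof. by move=> HP n; rewrite hornerM; apply: dividesMl. Qed.

Lemma annihilatesC a : annihilates a%:P -> a = 0.
Proof.
move=> Ha; apply/eqP/negPn/negP => a0.
by have [n []] := prime_exp_not_divides q_prime a0; have := Ha n; rewrite hornerC.
Qed.

(** The root is [- q] modulo [q ^+ 2], hence nonzero. *)
Lemma annihilatesX : ~ annihilates 'X.
Proof.
move=> HX; have := HX 2%N; rewrite hornerX => H2.
have := (approxP 2).2; rewrite horner_poly !big_ord_recl big_ord0 /sparse_coef /= fl1.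
rewrite expr0 expr1 addr0 mul1r mulr1 => H2'.
have : divides (q ^+ 2) q by rewrite -[X in divides _ X](addrK (approx 2)); apply: dividesB.
case=> z Ez; have q0 := prime_neq0 q_prime.
have : divides q 1 by exists z; apply: (mulfI q0); rewrite mulr1 {1}Ez expr2 mulrA.
by case: q_prime => q1 _ /(size_divides (oner_neq0 A)); rewrite size1; lia.
Qed.

Lemma annihilatesXn n : ~ annihilates 'X^n.
Proof.
elim: n => [|n IHn]; first by rewrite expr0 => /annihilatesC/eqP; rewrite oner_eq0.
by rewrite exprS => /annihilatesM[/annihilatesX|].
Qed.

Lemma sparse_skip n m : (n <= m)%N -> (0 < n)%N ->
  (forall i, (n <= i < m)%N -> ~~ fl i) -> sparse m = sparse n.
Proof.
move=> le_nm n0 Hi; apply/polyP => i; rewrite !coef_poly.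
have [lt_in|le_ni] := ltnP i n; first by rewrite (leq_trans lt_in).
case: ifP => // lt_im; rewrite /sparse_coef (negPf (Hi i _)) ?le_ni //.
by case: eqP => // E; rewrite E leqn0 in le_ni; move: n0; rewrite (eqP le_ni).
Qed.

Lemma size_sparse n : (1 < size (sparse n.+2))%N.
Proof.
rewrite ltnNge; apply/negP => /leq_sizeP/(_ 1%N (leqnn 1)).
by rewrite coef_poly /= /sparse_coef /= fl1 => /eqP; rewrite oner_eq0.
Qed.

Lemma height_sparse n : (height (sparse n.+1) <= s q + n)%N.
Proof.
rewrite /height; apply: leq_trans (_ : \sum_(i < n.+1) s (sparse_coef i) <= _)%N.
  have Hsz : (size (sparse n.+1) <= n.+1)%N by apply: size_poly.
  rewrite (big_ord_widen _ (fun i => s (sparse n.+1)`_i) Hsz) big_mkcond /=.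
  by apply: leq_sum => i _; case: ifP => // _; rewrite coef_poly ltn_ord.
rewrite big_ord_recl leq_add2l -[X in (_ <= X)%N](card_ord n) -sum1_card.
apply: leq_sum => i _; rewrite /sparse_coef /=; case: (fl _); rewrite ?size1 //.
by rewrite size0.
Qed.

Lemma no_annihilator P : annihilates P -> P = 0.
Proof.
move: {2}(size P) (leqnn (size P)) => n; elim: n P => [|n IHn] P.
  by rewrite leqn0 size_poly_eq0 => /eqP.
move=> le_Pn HP; apply/eqP; apply/negPn/negP => nzP.
have P1 : (1 < size P)%N.
  rewrite ltnNge; apply/negP => /size1_polyC EP; move: nzP.
  by rewrite EP (annihilatesC (a := P`_0)) ?eqxx // -EP.
(* A nonconstant common divisor [H] splits [P], up to a scalar, as [Q * H]. The cofactor [Q] is too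
   small to annihilate, by induction, so [H] does, and with it its multiple [G]. *)
have common G : resultant P G = 0 -> annihilates G.
  move/eqP; rewrite resultant_eq0 => Hgcd; set H := gcdp P G in Hgcd.
  have /Pdiv.Idomain.dvdpP[[c Q] /= c0 EQ] := dvdp_gcdl P G.
  have /Pdiv.Idomain.dvdpP[[d R] /= d0 ER] := dvdp_gcdr P G.
  have H0 : H != 0 by rewrite -size_poly_gt0; apply: leq_trans Hgcd.
  have Q0 : Q != 0.
    apply: contraNneq nzP => Q0; move/eqP: EQ.
    by rewrite Q0 mul0r -mul_polyC mulf_eq0 polyC_eq0 (negPf c0).
  have := annihilates_mull c%:P HP; rewrite mul_polyC EQ => /annihilatesM[HQ|HH].
    have lt_QP : (size Q < size P)%N.
      have := congr1 (fun r : {poly A} => size r) EQ.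
      by rewrite size_scale // size_mul // -/H => ->; move: Hgcd; case: (size H) => [|[|h]]; lia.
    by case/eqP: Q0; apply: IHn => //; rewrite -ltnS; apply: leq_trans le_Pn.
  have := annihilates_mull R HH; rewrite -ER -mul_polyC => /annihilatesM[/annihilatesC dz|//].
  by rewrite dz eqxx in d0.
(* By [x <= 2 ^ x], the resultant of [P] and [sparse a.+1] has size at most 2 to the power
   [height P * a + (size P).-1 * (s q + a)], and this exponent is at most [C * a.+1]. *)
pose C := (height P + (size P).-1 * (s q).+1)%N.
have small a b : (0 < a)%N -> (C * a.+1 < b)%N -> (a < b)%N ->
    (forall i, (a < i < b)%N -> ~~ fl i) -> annihilates (sparse a.+1).
  move=> a0 Cab lt_ab Hfl; apply: common; apply/eqP/negPn/negP => nzR.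
  case: a a0 Cab lt_ab Hfl nzR => // a _ Cab lt_ab Hfl nzR.
  (* Evaluate the resultant, a combination of [P] and the truncation, at [approx b]: both values are
     divisible by [q ^+ b], because inside the gap the truncation equals [sparse b]. *)
  have [[u v] /= _ Euv] := resultant_in_ideal P1 (size_sparse a).
  have HR : divides (q ^+ b) (resultant P (sparse a.+2)).
    have := congr1 (horner^~ (approx b)) Euv; rewrite hornerC !hornerE => ->.
    apply: dividesD; first by apply: dividesMl.
    apply: dividesMl; rewrite -(sparse_skip (m := b)) //; exact: (approxP b).2.
  have := size_divides nzR HR; rewrite sizeX => Hle.
  have := leq_trans Hle (size_resultant _ _); apply/negP; rewrite -ltnNge.
  case: q_prime => q1 _.
  apply: leq_trans (_ : 2 ^ b <= _)%N; last by rewrite leq_exp2r //; lia.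
  have le2 (x y k : nat) : (x <= y)%N -> (x ^ k <= 2 ^ (y * k))%N.
    move=> le_xy; rewrite expnM; case: k => // k; rewrite leq_exp2r //.
    by apply: leq_trans le_xy _; apply: ltnW; apply: ltn_expl.
  have Hsz : ((size (sparse a.+2)).-1 <= a.+1)%N.
    by have := size_poly a.+2 sparse_coef; rewrite -/(sparse a.+2); lia.
  apply: leq_ltn_trans (leq_mul (le2 _ _ _ (leqnn _)) (le2 _ _ _ (height_sparse _))) _.
  rewrite -expnD ltn_exp2l //; apply: leq_ltn_trans Cab; rewrite /C.
  move: (height P) (size (sparse a.+2)).-1 (size P).-1 (s q) Hsz => h z d e Hsz; nia.
(* The successor guarantees [b < c] even for [C = 0]. *)
have [a [b [c [Hab Ca Cb flb Hfl]]]] := fl_gaps C.+1.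
have lt_bc : (b < c)%N by nia.
have Ha : annihilates (sparse a.+1).
  apply: (small a b); [lia | nia | lia |] => i Hi; apply: Hfl; lia.
have Hb : annihilates (sparse b.+1).
  apply: (small b c); [lia | nia | lia |] => i Hi; apply: Hfl; lia.
apply: (@annihilatesXn b) => n'.
have -> : 'X^b = sparse b.+1 - sparse a.+1.
  have <- : sparse b = sparse a.+1.
    by apply: sparse_skip; [lia | lia |] => i Hi; apply: Hfl; lia.
  apply/polyP => i; rewrite coefB !coef_poly coefXn ltnS leq_eqVlt.
  have [->|ne_ib] := eqVneq i b.
    by rewrite ltnn subr0 /= /sparse_coef flb; case: eqP => // b0; lia.
  by rewrite subrr.
by rewrite hornerD hornerN; apply: dividesB.
Qed.

End SparseSeries.
End Euclidean.

Lemma series_mul_trunc (T : comNzRingType) (f g h : series T) N :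
  f =1 series_mul g h ->
  exists w : {poly T}, (\poly_(i < N) g i) * (\poly_(i < N) h i) =
    \poly_(i < N) f i + w * 'X^N.
Proof.
move=> Ef; set P := _ * _; exists (drop_poly N P).
rewrite -{1}[P](poly_take_drop N); congr (_ + _); apply/polyP => n.
rewrite coef_take_poly coef_poly; case: ltnP => // lt_nN.
rewrite Ef coefM; apply: eq_bigr => i _; rewrite !coef_poly.
by rewrite (leq_ltn_trans _ lt_nN) ?(leq_ltn_trans _ lt_nN) ?leq_subr // -ltnS.
Qed.

(** * From a factorization over [T] to an annihilator over [A] *)

Section Transfer.
Variables (T : comNzRingType) (A : idomainType) (s : A -> nat) (k : nat).
Hypothesis Hs : euclidean_size s.
(* [R h x] reads "the polynomial [h] represents [x]", possibly only up to an
   ideal of [T]: it is a subring of the product ring projecting onto both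
   factors. *)
Variable R : {mpoly A[k]} -> T -> Prop.
Hypotheses (R1 : R 1 1) (RN : forall h x, R h x -> R (- h) (- x))
  (RD : forall h x h' x', R h x -> R h' x' -> R (h + h') (x + x'))
  (RM : forall h x h' x', R h x -> R h' x' -> R (h * h') (x * x'))
  (R_total : forall h, exists x, R h x) (R_onto : forall x, exists h, R h x)
  (R_const : forall a, R a%:MP 0 -> a = 0).
Variable fl : nat -> bool.
Hypothesis fl1 : fl 1%N.
Hypothesis fl_gaps : wide_gaps fl.

Lemma represents0 : R 0 0.
Proof. by rewrite -(subrr 1) -[X in R _ X](subrr 1); apply: RD (RN _). Qed.

Lemma represents_sum (I : finType) (F : I -> {mpoly A[k]}) (G : I -> T) :
  (forall i, R (F i) (G i)) -> R (\sum_i F i) (\sum_i G i).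
Proof. by move=> H; elim/big_rec2: _ => [|i x y _]; [exact: represents0 | exact: RD]. Qed.

Lemma represents_exp h x n : R h x -> R (h ^+ n) (x ^+ n).
Proof. by move=> H; elim: n => [|n IHn]; rewrite ?expr0 // !exprS; apply: RM. Qed.

Theorem sparse_not_poly_times_unit : exists qT : T, forall f : series T,
  (forall n, f n = if n == 0%N then qT else (fl n)%:R) -> ~ poly_times_unit f.
Proof.
pose I h := R h 0.
have ID x y : I x -> I y -> I (x + y).
  by move=> Ix Iy; rewrite /I -(addr0 0); apply: RD.
have IM x y : I x -> I (y * x).
  by move=> Ix; have [z Hz] := R_total y; rewrite /I -(mulr0 z); apply: RM.
have IZ a x : I x -> I (a *: x) by rewrite -mul_mpolyC; apply: IM.
have IB x y : I x -> I y -> I (x - y).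
  by move=> Ix Iy; apply: ID => //; rewrite -scaleN1r; apply: IZ.
have [c [c0 [std [std_add std_scale std_I std1 std_red]]]] := normal_form represents0 ID IM R_const.
have [q [q_prime qc]] := ex_prime_not_dividing Hs c0.
have [qT RqT] := R_total q%:MP.
exists qT => f Ef [p [u [[v Euv] Efpu]]].
have q0 := prime_neq0 Hs q_prime.
(* Since [p 0 * u 0 = f 0], the scaled polynomial has constant coefficient [qT]. The bound [m] is
   positive even for [p = 0], so index 0 is always covered. *)
pose p' := u 0%N *: p; pose m := (size p).+1.
have Ep'0 : p'`_0 = qT.
  by have := Ef 0%N; rewrite /= Efpu /series_mul big_ord1 subnn coefZ mulrC.
have [pl [Hpl Epl0]] : exists pl : nat -> {mpoly A[k]},
    (forall i, R (pl i) p'`_i) /\ pl 0%N = q%:MP.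
  have [g Hg] := functional_choice _ R_onto.
  by exists (fun i => if i is 0%N then q%:MP else g p'`_i); split=> // -[|i] //; rewrite Ep'0.
have std_red' i : exists er : nat * {mpoly A[k]}, std er.2 /\ I (c ^+ er.1 *: pl i - er.2).
  by have [e [r H]] := std_red (pl i); exists (e, r).
have [er Her] := functional_choice _ std_red'.
(* As [p] has finitely many coefficients, one power of [c] serves for all their normal forms. *)
pose E := (\max_(i < m) (er i).1)%N.
pose r i := c ^+ (E - (er i).1) *: (er i).2.
have std_r i : std (r i) by apply: (std_scale); case: (Her i).
have Hr i : (i < m)%N -> I (c ^+ E *: pl i - r i).
  move=> im; have le_eE : ((er i).1 <= E)%N by apply: (leq_bigmax (Ordinal im)).
  rewrite -(subnKC le_eE) addnC exprD -scalerA -scalerBr; apply: IZ.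
  by case: (Her i).
pose P := \poly_(i < m) (r i)@_0%MM.
have std_sum (J : finType) (F : J -> {mpoly A[k]}) : (forall i, std (F i)) -> std (\sum_i F i).
  move=> HF; elim/big_ind: _ => [|x y|i _]; [|exact: std_add|exact: HF].
  by rewrite -(scale0r 1); apply: (std_scale).
have HP : annihilates q fl P.
  move=> n; set a := approx q fl n.
  have [[b Eb] _] := approxP q fl1 n.
  (* The approximation is represented by an exact multiple of [qT], so [x ^+ N] is a multiple of
     [qT ^+ n] and cutting the series at [N] is harmless modulo that power. *)
  have [bT RbT] := R_total b%:MP; pose x := qT * bT.
  have Rx : R a%:MP x by rewrite /a Eb mpolyCM; apply: RM.
  pose N := (n + m)%N.
  have Hx : exists y, x ^+ N = qT ^+ n * y.
    by exists (qT ^+ m * bT ^+ N); rewrite exprMn exprD mulrA.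
  (* Divisibility by [q ^+ n] holds in [A]; it passes to [T] only up to an element [z] represented
     by 0, as a polynomial may represent several elements. *)
  have [z [y0 [Rz EF]]] : exists z y0, R 0 z /\ (\poly_(i < N) f i).[x] = qT ^+ n * y0 + z.
    have [d Ed] := sparse_approx q fl1 (leq_addr m n).
    have [dT RdT] := R_total d%:MP.
    exists ((\poly_(i < N) f i).[x] - qT ^+ n * dT), dT; split; last by rewrite addrC subrK.
    rewrite -(subrr ((sparse q fl N).[a])%:MP) {2}Ed mpolyCM rmorphXn.
    apply: RD; last by apply: RN; apply: RM => //; apply: represents_exp.
    rewrite !horner_poly rmorph_sum; apply: represents_sum => i; rewrite rmorphM rmorphXn /=.
    apply: RM; last exact: represents_exp.
    rewrite Ef /sparse_coef; case: eqP => // _; case: (fl i); first by rewrite mpolyC1.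
    by rewrite mpolyC0; apply: represents0.
  have [y [y' Ep]] : exists y y', p.[x] = qT ^+ n * y + z * y'.
    have [w Ew] := series_mul_trunc N Efpu.
    have [w' Ew'] := series_mul_trunc N (fsym Euv).
    have EpN : \poly_(i < N) series_of_poly p i = p.
      apply/polyP => i; rewrite coef_poly /series_of_poly; case: ltnP => // le_Ni.
      rewrite nth_default //; apply: leq_trans le_Ni.
      by rewrite /N /m addnS; apply: leqW; apply: leq_addl.
    have Eone : \poly_(i < N) series_one T i = 1.
      apply/polyP => i; rewrite coef_poly coef1 /series_one; case: ltnP => //.
      by rewrite /N /m addnS; case: i.
    have [yN EyN] := Hx.
    pose U := (\poly_(i < N) u i).[x]; pose V := (\poly_(i < N) v i).[x].
    have E1 : p.[x] * U = (\poly_(i < N) f i).[x] + w.[x] * x ^+ N.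
      by rewrite /U -{1}EpN -hornerM Ew hornerD hornerM hornerXn.
    have E2 : U * V = 1 + w'.[x] * x ^+ N.
      by rewrite /U /V -hornerM Ew' Eone hornerD hornerM hornerXn hornerC.
    exists (y0 * V + w.[x] * yN * V - p.[x] * w'.[x] * yN), V.
    rewrite [LHS](_ : _ = (p.[x] * U) * V - p.[x] * (U * V - 1)); last by ring.
    by rewrite E1 E2 EF EyN; ring.
  pose H := \sum_(i < m) a ^+ i *: pl i.
  have HH : R H p'.[x].
    have Hsz : (size p' <= m)%N by apply: leq_trans (size_scale_leq _ _) (leqnSn _).
    rewrite (horner_coef_wide x Hsz); apply: represents_sum => i.
    rewrite -mul_mpolyC mulrC; apply: RM => //.
    by rewrite rmorphXn; apply: represents_exp.
  have [yt Ryt] := R_onto (u 0%N * y); have [zt Rzt] := R_onto (u 0%N * y').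
  have IH : I (H - q ^+ n *: yt).
    have -> : H - q ^+ n *: yt = H - ((q%:MP ^+ n) * yt + 0 * zt).
      by rewrite mul0r addr0 -mul_mpolyC rmorphXn.
    rewrite /I (_ : 0 = p'.[x] - (qT ^+ n * (u 0%N * y) + z * (u 0%N * y'))); last first.
      by rewrite hornerZ Ep; ring.
    by apply: RD => //; apply: RN; apply: RD; apply: RM => //; apply: represents_exp.
  have [e [rho [std_rho Irho]]] := std_red yt.
  pose S := \sum_(i < m) a ^+ i *: r i.
  have IS : I (c ^+ E *: H - S).
    rewrite /H /S scaler_sumr -sumrB; elim/big_ind: _ => [|? ?|i _]; [exact: represents0|exact: ID|].
    by rewrite scalerA mulrC -scalerA -scalerBr; apply: IZ; apply: Hr.
  (* Both terms are standard, so their congruence modulo [I] is an equality of polynomials. Its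
     constant coefficients show that [q ^+ n] divides [c ^+ e * P.[a]]. *)
  have W0 : c ^+ e *: S - (c ^+ E * q ^+ n) *: rho = 0.
    apply: std_I.
      apply: (std_add); last by rewrite -scaleN1r; apply: (std_scale); apply: (std_scale).
      by apply: (std_scale); apply: std_sum => i; apply: (std_scale).
    have -> : c ^+ e *: S - (c ^+ E * q ^+ n) *: rho =
        (c ^+ e * c ^+ E) *: (H - q ^+ n *: yt) + (c ^+ E * q ^+ n) *: (c ^+ e *: yt - rho)
        - c ^+ e *: (c ^+ E *: H - S).
      rewrite !scalerBr !scalerA (mulrC (c ^+ E * q ^+ n)) (mulrA (c ^+ e)); ring.
    by apply: IB; [apply: ID|]; apply: IZ.
  have ES : S@_0%MM = P.[a].
    by rewrite horner_poly raddf_sum /=; apply: eq_bigr => i _; rewrite mcoeffZ mulrC.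
  apply: (prime_exp_cancel Hs q_prime (c := c ^+ e)).
    by move/(divides_prime_exp Hs q_prime).
  exists (c ^+ E * rho@_0%MM); have := congr1 (fun g : {mpoly A[k]} => g@_0%MM) W0.
  rewrite /= mcoeffB !mcoeffZ mcoeff0 ES => /eqP; rewrite subr_eq0 => /eqP->; ring.
have P0 := no_annihilator Hs q_prime fl1 fl_gaps HP.
(* Constants are standard, hence equal to their normal forms; so [P] has the nonzero constant
   coefficient [c ^+ E * q]. *)
have Er0 : r 0%N = (c ^+ E * q)%:MP.
  apply/eqP; rewrite eq_sym -subr_eq0; apply/eqP; apply: std_I.
    apply: (std_add); last by rewrite -scaleN1r; apply: (std_scale).
    by rewrite -[X in std X]mulr1 mul_mpolyC; apply: (std_scale).
  by have := Hr 0%N isT; rewrite Epl0 -mul_mpolyC -mpolyCM.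
have := congr1 (fun g : {poly A} => g`_0) P0; rewrite /= coef_poly coef0 /= Er0 mcoeffC eqxx mulr1.
by apply/eqP; rewrite mulf_neq0 ?expf_neq0.
Qed.

End Transfer.

(** * Representing a finitely generated ring *)

Lemma int_euclidean_size : euclidean_size (fun z : int => `|z|%N).
Proof.
split.
- by move=> x; rewrite absz_eq0.
- exact: abszM.
- by move=> x y; lia.
- move=> x y y0; exists (x %/ y)%Z; rewrite [X in (absz X < _)%N](_ : _ = (x %% y)%Z).
    by have := ltz_mod x y0; have := modz_ge0 x y0; lia.
  by rewrite {1}(divz_eq x y); ring.
- by exists 4.
Qed.

Lemma poly_euclidean_size (F : fieldType) :
  euclidean_size (fun p : {poly F} => if p == 0 then 0%N else (2 ^ (size p).-1)%N).
Proof.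
have pos (n : nat) : (0 < 2 ^ n)%N by rewrite expn_gt0.
split.
- by move=> x; case: (eqVneq x 0) => // _; apply/negbTE; rewrite -lt0n.
- move=> x y; rewrite mulf_eq0; case: (eqVneq x 0) => //= x0.
  case: (eqVneq y 0) => [|y0] /=; first by rewrite muln0.
  rewrite -expnD size_mul //; congr (2 ^ _)%N.
  by move: x0 y0; rewrite -!size_poly_gt0; move: (size x) (size y) => a b; lia.
- move=> x y; have [->|x0] := eqVneq x 0; first by rewrite add0r.
  have [->|y0] := eqVneq y 0; first by rewrite addr0 (negPf x0) addn0.
  case: ifP => // _; have := size_polyD x y; rewrite leq_max => /orP[] H.
    by apply: leq_trans (leq_addr _ _); rewrite leq_exp2l // -!subn1 leq_sub2r.
  by apply: leq_trans (leq_addl _ _); rewrite leq_exp2l // -!subn1 leq_sub2r.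
- move=> x y y0; exists (x %/ y); rewrite (negPf y0).
  rewrite (_ : x - _ = x %% y); last by rewrite {1}(divp_eq x y) addrC addKr.
  case: (eqVneq (x %% y) 0) => // r0; have := ltn_modpN0 x y0; rewrite ltn_exp2l //.
  by move: r0; rewrite -size_poly_gt0; move: (size _) (size _) => a b; lia.
- by exists 'X^2; rewrite -size_poly_eq0 size_polyXn.
Qed.

Definition value (T : comNzRingType) (x : T) (g : {poly int}) : T := (map_poly intr g).[x].

Definition reduction (p : nat) (g : {poly int}) : {poly 'F_p} := map_poly intr g.

Section Representations.
Variables (T : comNzRingType) (k : nat) (t : 'I_k -> T).
Hypothesis t_generates : generates t.
Variable fl : nat -> bool.
Hypothesis fl1 : fl 1%N.
Hypothesis fl_gaps : wide_gaps fl.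

Definition sparse_counterexample := exists qT : T, forall f : series T,
  (forall n, f n = if n == 0%N then qT else (fl n)%:R) -> ~ poly_times_unit f.

Lemma char0_counterexample : (forall n, (0 < n)%N -> n%:R != 0 :> T) ->
  sparse_counterexample.
Proof.
move=> char0; pose R (h : {mpoly int[k]}) x := eval_at t h = x.
apply: (sparse_not_poly_times_unit int_euclidean_size (R := R)) => //; rewrite /R /eval_at.
- exact: rmorph1.
- by move=> h x <-; rewrite rmorphN.
- by move=> h x h' x' <- <-; rewrite rmorphD.
- by move=> h x h' x' <- <-; rewrite rmorphM.
- by move=> h; eexists.
move=> a; rewrite mmapC; case: a => n Ha.
  by case: n Ha => // n Ha; have /eqP[] := char0 n.+1 isT.
by have /eqP[] := char0 n.+1 isT; apply/eqP; rewrite -oppr_eq0; apply/eqP.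
Qed.

Variables (p : nat) (i0 : 'I_k).
Hypothesis p_prime : prime p.

Local Notation int_eval := (value (t i0)).
Local Notation reduce := (reduction p).

Lemma reduce_eq0 g : reduce g = 0 -> exists h, g = p%:R * h.
Proof.
move=> Hg; have H i : exists z, g`_i = p%:Z * z.
  have : (reduce g)`_i = 0 by rewrite Hg coef0.
  rewrite coef_map => /eqP; rewrite -(dvdz_pcharf (pchar_Fp p_prime)) => /dvdzP[z ->].
  by exists z; rewrite mulrC.
have [f Hf] := functional_choice _ H.
exists (\poly_(i < size g) f i); apply/polyP => i.
rewrite -polyC_natr coefCM coef_poly; case: ltnP => [_|le_gi].
  by rewrite Hf; congr (_ * _); rewrite natz.
by rewrite nth_default // mulr0.
Qed.

Lemma reduce_onto (g : {poly 'F_p}) : exists h, reduce h = g.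
Proof.
exists (\poly_(i < size g) (nat_of_ord g`_i)%:Z); apply/polyP => i.
rewrite coef_map coef_poly; case: ltnP => [_|le_gi]; last by rewrite nth_default.
by rewrite /= -pmulrn natr_Zp.
Qed.

Lemma valueM g h : int_eval (g * h) = int_eval g * int_eval h.
Proof. by rewrite /value rmorphM hornerM. Qed.

Lemma valueD g h : int_eval (g + h) = int_eval g + int_eval h.
Proof. by rewrite /value rmorphD hornerD. Qed.

Lemma value_nat n : int_eval n%:R = n%:R.
Proof. by rewrite /value rmorph_nat -polyC_natr hornerC. Qed.

Lemma reduce0_eval g : reduce g = 0 -> divides p%:R (int_eval g).
Proof.
by case/reduce_eq0 => h ->; exists (int_eval h); rewrite valueM value_nat.
Qed.

(** The hypothesis says that [t i0] is transcendental over the prime field modulo [p]. As [T] need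
    not be an algebra over that field, [h] represents [x] when some integral lift of [h] evaluates
    to [x] modulo [p]; the coefficient variable is sent to [t i0] as well. *)
Lemma charp_counterexample :
  (forall g, divides p%:R (int_eval g) -> reduce g = 0) -> sparse_counterexample.
Proof.
move=> transc.
pose ev := mmap (horner_eval (t i0) \o map_poly (intr : int -> T)) t.
pose red := map_mpoly (map_poly (intr : int -> 'F_p)) : {mpoly {poly int}[k]} -> _.
pose R h x := exists H, red H = h /\ divides p%:R (ev H - x).
have redB g h : red (g - h) = red g - red h by rewrite /red rmorphB.
have redC g : red g%:MP = (reduce g)%:MP by rewrite /red map_mpolyC.
have evC g : ev g%:MP = int_eval g by rewrite /ev mmapC.
have evB g h : ev (g - h) = ev g - ev h by rewrite /ev rmorphB.
apply: (sparse_not_poly_times_unit (poly_euclidean_size 'F_p) (R := R)) => //; rewrite /R.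
- exists 1; rewrite /red /ev !rmorph1 subrr; split=> //; exact: divides0.
- move=> h x [H [<- [z Ez]]]; exists (- H); rewrite /red /ev !rmorphN; split=> //.
  by exists (- z); rewrite mulrN -Ez opprB opprK addrC.
- move=> h x h' x' [H [<- HH]] [H' [<- HH']]; exists (H + H'); rewrite /red /ev !rmorphD.
  by split=> //; rewrite opprD addrACA; apply: dividesD.
- move=> h x h' x' [H [<- HH]] [H' [<- HH']]; exists (H * H'); rewrite /red /ev !rmorphM.
  split=> //; rewrite -/(ev H) -/(ev H').
  have -> : ev H * ev H' - x * x' = (ev H - x) * ev H' + x * (ev H' - x') by ring.
  by apply: dividesD; [apply: dividesMr | apply: dividesMl].
- move=> h; have [lift Hlift] := functional_choice _ reduce_onto.
  pose H : {mpoly {poly int}[k]} := \sum_(m <- msupp h) lift (h@_m) *: 'X_[m].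
  exists (ev H), H; split; last by rewrite subrr; apply: divides0.
  rewrite /red /H raddf_sum [RHS]mpolyE; apply: eq_bigr => m _.
  by rewrite -!mul_mpolyC /= rmorphM /= map_mpolyC map_mpolyX; congr (_%:MP * _); apply: Hlift.
- move=> x; have [P <-] := t_generates x.
  pose H : {mpoly {poly int}[k]} := \sum_(m <- msupp P) (P@_m)%:P *: 'X_[m].
  exists (red H), H; split=> //.
  rewrite (_ : ev H = eval_at t P) ?subrr; first exact: divides0.
  rewrite [in RHS](mpolyE P) /ev /eval_at /H !raddf_sum; apply: eq_bigr => m _ /=.
  by rewrite !mmapZ /= !mmapX /horner_eval map_polyC hornerC.
move=> g [H [EH HH]]; rewrite subr0 in HH.
(* The lift of a constant need not be constant, but the rest of [H] reduces to 0, so its value is a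
   multiple of [p]. *)
pose H0 := H@_0%MM.
have E0 : reduce H0 = g.
  by have := congr1 (fun h : {mpoly {poly 'F_p}[k]} => h@_0%MM) EH; rewrite mcoeff_map_mpoly mcoeffC eqxx mulr1.
rewrite -E0; apply: transc.
have -> : int_eval H0 = ev H - ev (H - H0%:MP).
  by rewrite evB evC subKr.
apply: dividesB => //.
have : red (H - H0%:MP) = 0.
  by rewrite redB EH redC E0 subrr.
move: (H - _) => Q EQ; rewrite /ev [Q]mpolyE raddf_sum /=.
elim/big_ind: _ => [|x y|m _]; [exact: divides0 | exact: dividesD |].
rewrite mmapZ; apply: dividesMr; apply: reduce0_eval.
by have := congr1 (fun h : {mpoly {poly 'F_p}[k]} => h@_m) EQ; rewrite mcoeff_map_mpoly mcoeff0.
Qed.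

Lemma algebraic_monic g : reduce g != 0 -> divides p%:R (int_eval g) ->
  exists2 G : {poly int}, G \is monic & divides p%:R (int_eval G).
Proof.
move=> nz Hg; pose a := lead_coef (reduce g); pose d := (size (reduce g)).-1.
have [r Er] := reduce_onto (a^-1 *: reduce g - 'X^d).
have [b Eb] := reduce_onto (a^-1)%:P.
(* The lift [r] is arbitrary and may have spurious coefficients, multiples of [p], in degree [d] or
   above; these are cut off to keep the sum monic. *)
exists ('X^d + take_poly d r).
  rewrite monicE lead_coefDl ?lead_coefXn // size_polyXn ltnS; exact: size_take_poly.
have -> : int_eval ('X^d + take_poly d r) =
    int_eval b * int_eval g + int_eval ('X^d + take_poly d r - b * g).
  by rewrite -valueM -valueD [in RHS](addrC (b * g)) subrK.
apply: dividesD; first exact: dividesMl.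
apply: reduce0_eval; rewrite /reduction rmorphB rmorphD rmorphM /= map_polyXn.
rewrite -/(reduce _) -/(reduce b) -/(reduce g) Eb mul_polyC.
have -> : reduce (take_poly d r) = a^-1 *: reduce g - 'X^d.
  rewrite -Er; apply/polyP => i; rewrite !coef_map coef_take_poly.
  case: ltnP => // le_di; rewrite /= -(coef_map _ r) -/(reduce r) Er.
  rewrite coefB coefZ coefXn; move: le_di; rewrite leq_eqVlt => /predU1P[<-|lt_di].
    by rewrite eqxx -[_`_d]/a mulVf ?subrr // lead_coef_eq0.
  rewrite gtn_eqF // nth_default ?mulr0 ?subrr //.
  by move: lt_di; rewrite /d; case: (size _).
by rewrite (addrC 'X^d) subrK subrr.
Qed.

End Representations.

(** Peel off one prime factor of [n] at a time and multiply the monic polynomials; repeated factors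
    do no harm. *)
Lemma monic_mod (T : comNzRingType) (x : T) :
  (forall p, prime p -> exists2 G : {poly int}, G \is monic & divides p%:R (value x G)) ->
  forall n, (0 < n)%N ->
  exists2 G : {poly int}, G \is monic & divides n%:R (value x G).
Proof.
move=> Hp n; have [m] := ubnP n; elim: m n => // m IHm n lt_nm n0.
have [n1|n1] := leqP n 1.
  have -> : n = 1%N by lia.
  by exists 1; [exact: monic1 | exists (value x 1); rewrite mul1r].
have En : n = (n %/ pdiv n * pdiv n)%N by rewrite divnK ?pdiv_dvd.
have [||G monG [y Ey]] := IHm (n %/ pdiv n)%N.
- have := ltn_Pdiv (prime_gt1 (pdiv_prime n1)) n0; lia.
- by rewrite divn_gt0 ?pdiv_gt0 // dvdn_leq ?pdiv_dvd.
have [G' monG' [y' Ey']] := Hp _ (pdiv_prime n1).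
exists (G * G'); first by rewrite monicMl.
exists (y * y'); rewrite /value rmorphM hornerM -/(value x G) -/(value x G') Ey Ey'.
by rewrite [in RHS]En natrM; ring.
Qed.

(** Integral generators make [T] the integer span of the monomials with exponents below [d], and
    coefficients matter only modulo [n]. *)
Lemma finite_of_integral (T : comNzRingType) (k : nat) (t : 'I_k -> T) (n : nat) :
  generates t -> (0 < n)%N -> n%:R = 0 :> T ->
  (forall i, exists2 G : {poly int}, G \is monic & value (t i) G = 0) ->
  ~ infinite_type T.
Proof.
move=> t_gen n0 nT0 Hmon; apply.
have HG i : exists G : {poly int}, G \is monic /\ value (t i) G = 0.
  by have [G monG EG] := Hmon i; exists G.
have [G HG'] := functional_choice _ HG.
pose d := (\max_i size (G i))%N.
pose mon (f : {ffun 'I_k -> 'I_d}) : T := \prod_i t i ^+ f i.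
have power i m : exists c : 'I_d -> int, t i ^+ m = \sum_e (c e)%:~R * t i ^+ e.
  have [monG EG] := HG' i; pose r := Pdiv.CommonRing.rmodp 'X^m (G i).
  have size_r : (size r <= d)%N.
    apply: leq_trans (leq_bigmax i); apply: ltnW.
    by apply: Pdiv.CommonRing.ltn_rmodpN0; apply: monic_neq0.
  exists (fun e => r`_e).
  have : value (t i) 'X^m = value (t i) r.
    rewrite {1}(Pdiv.RingMonic.rdivp_eq monG 'X^m) /value rmorphD rmorphM hornerD hornerM.
    by rewrite -/(value _ (G i)) EG mulr0 add0r.
  rewrite {1}/value map_polyXn hornerXn => ->.
  rewrite /value (horner_coef_wide (n := d)); last by apply: leq_trans (size_poly _ _) _.
  by apply: eq_bigr => e _; rewrite coef_map.
pose W x := exists c : {ffun 'I_k -> 'I_d} -> int, x = \sum_f (c f)%:~R * mon f.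
have WT x : W x.
  have [P <-] := t_gen x; rewrite /eval_at [P]mpolyE raddf_sum /=.
  elim/big_ind: _ => [|x1 x2 [c1 ->] [c2 ->]|m _].
  - by exists (fun=> 0); rewrite big1 // => f _; rewrite mul0r.
  - exists (fun f => c1 f + c2 f); rewrite -big_split; apply: eq_bigr => f _ /=.
    by rewrite intrD mulrDl.
  rewrite mmapZ mmapX /mmap1.
  have [c Hc] := functional_choice _ (fun i => power i (m i)).
  under eq_bigr => i _ do rewrite Hc.
  rewrite bigA_distr_bigA mulr_sumr.
  exists (fun f => P@_m * \prod_i c i (f i)); apply: eq_bigr => f _.
  by rewrite big_split /= intrM rmorph_prod mulrA.
exists [seq \sum_f (c f : nat)%:R * mon f | c : {ffun {ffun 'I_k -> 'I_d} -> 'I_n}].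
move=> x; have [c ->] := WT x.
have Hlt z : (`|(z %% n)%Z| < n)%N.
  by have := @ltz_pmod z n; have := @modz_ge0 z n; lia.
apply/imageP; exists [ffun f => Ordinal (Hlt (c f))] => //.
apply: eq_bigr => f _; rewrite ffunE /=; congr (_ * _).
rewrite {1}(divz_eq (c f) n) intrD intrM [n%:~R]nT0 mulr0 add0r.
have := @modz_ge0 (c f) n; case: (c f %% n)%Z => // i; lia.
Qed.

Theorem exists_counterexample (T : comNzRingType) (k : nat) (t : 'I_k -> T) (fl : nat -> bool) :
  generates t -> infinite_type T -> fl 1%N -> wide_gaps fl ->
  sparse_counterexample T fl.
Proof.
move=> t_gen T_inf fl1 fl_gaps.
have [char0|] := classic (forall n, (0 < n)%N -> n%:R != 0 :> T).
  exact: (char0_counterexample t_gen).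
case/not_all_ex_not => n Hn; have [n0 /negP] := imply_to_and _ _ Hn.
rewrite negbK => /eqP nT0.
(* Without a counterexample no generator is transcendental modulo any prime; each is then a root of
   a monic polynomial modulo every prime, so modulo [n], which is 0 in [T]. *)
apply: NNPP => noce; apply: (finite_of_integral t_gen n0 nT0) T_inf => i.
suff /monic_mod/(_ n n0)[G monG [y Ey]] : forall p, prime p ->
    exists2 G : {poly int}, G \is monic & divides p%:R (value (t i) G).
  by exists G => //; rewrite Ey nT0 mul0r.
move=> p p_prime.
have : ~ forall g, divides p%:R (value (t i) g) -> reduction p g = 0.
  by move/(charp_counterexample t_gen fl1 fl_gaps p_prime).
case/not_all_ex_not => g Hg'; have [Hg /eqP nz] := imply_to_and _ _ Hg'.
exact: (algebraic_monic p_prime nz Hg).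
Qed.

Local Close Scope ring_scope.

(** * Undecidability *)

Fixpoint tick_time (j : nat) : nat :=
  if j is j'.+1 then tick_time j' + tick_time j' ^ 2 + 1 else 1.

Lemma clockS n : clock n.+1 = clock_step (clock n).
Proof. by []. Qed.

Lemma clock_tick j i : i <= tick_time j ^ 2 ->
  clock (tick_time j + i) = (tick_time j + i, tick_time j ^ 2 - i, i == 0).
Proof.
have step_clock j' i' : i' < tick_time j' ^ 2 ->
    clock (tick_time j' + i') = (tick_time j' + i', tick_time j' ^ 2 - i', i' == 0) ->
    clock (tick_time j' + i'.+1) = (tick_time j' + i'.+1, tick_time j' ^ 2 - i'.+1, false).
  by move=> Hi E; rewrite addnS clockS E /clock_step subn_gt0 Hi -subnS.
elim: j i => [|j IHj]; elim=> [|i IHi] Hi.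
- by [].
- by apply: step_clock; rewrite ?IHi ?(ltnW Hi).
- have E := IHj _ (leqnn _).
  by rewrite addn0 subn0 [tick_time j.+1]/= addn1 clockS E subnn.
- by apply: step_clock; rewrite ?IHi ?(ltnW Hi).
Qed.

Definition ticks (n : nat) : bool := (clock n).2.

Lemma ticks_time j : ticks (tick_time j).
Proof. by rewrite /ticks -[tick_time j]addn0 clock_tick. Qed.

Lemma ticks_between j i : tick_time j < i < tick_time j.+1 -> ~~ ticks i.
Proof.
move=> Hi; rewrite /ticks -(subnKC (_ : tick_time j <= i)); last by lia.
by rewrite clock_tick /=; move: Hi => /=; lia.
Qed.

Lemma leq_tick_time j : j < tick_time j.
Proof. by elim: j => //= j IHj; lia. Qed.

Lemma ticks_gaps : wide_gaps ticks.
Proof.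
move=> C.
have Hgap j : C <= tick_time j -> C * (tick_time j).+1 < tick_time j.+1.
  by move=> /= HC; nia.
(* Since [tick_time C] exceeds [C], quadratic growth already beats the factor [C] there. *)
exists (tick_time C), (tick_time C.+1), (tick_time C.+2).
have HC := leq_tick_time C; have HC1 := leq_tick_time C.+1.
split.
- by move: HC => /=; lia.
- by apply: Hgap; lia.
- by apply: Hgap; lia.
- exact: ticks_time.
move=> i Hi ne_i; have [lt_i|lt_i|E] := ltngtP i (tick_time C.+1).
- by apply: (@ticks_between C); lia.
- by apply: (@ticks_between C.+1); lia.
- by rewrite E eqxx in ne_i.
Qed.

Lemma says_false_outputs D w n : says_false D (run D n (init w)) ->
  forall b, outputs D w [:: b] -> b = false.
Proof.
case/andP=> Hn /eqP Sn b [m [Hm /(_ 0 isT)Rm]].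
have Hn' : step D (run D n (init w)) = None by case: step Hn.
have E : run D m (init w) = run D n (init w).
  by case: (leqP m n) => [le|/ltnW le]; [symmetry|]; apply: run_halted.
by move: Rm; rewrite E addr0 Sn; case: b.
Qed.

Lemma outputs_says_false D w : outputs D w [:: false] ->
  exists n, forall m, n <= m -> says_false D (run D m (init w)).
Proof.
case=> n [Hn /(_ 0 isT)Rn]; exists n => m le_nm.
by rewrite (run_halted Hn le_nm) /says_false Hn -[c_head _]addr0 Rn.
Qed.

(** The coefficients take only the values 0, 1 and [qT], so three fixed code words suffice and the
    machine never computes in [T]. *)
Lemma encodes_exists (T : comNzRingType) (k : nat) (t : 'I_k -> T) x :
  generates t -> exists v, encodes t v x.
Proof.
case/(_ x) => p Ep; pose s := [seq (p@_m, m)%R | m <- msupp p].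
exists (code_seq (@code_term k) s), p; split=> //; exists s; split=> //.
by rewrite big_map -mpolyE.
Qed.

Lemma finite_poly_times_unit (T : comNzRingType) (f : series T) n :
  (forall m, n <= m -> f m = 0%R) -> poly_times_unit f.
Proof.
move=> Hf; exists (\poly_(i < n) f i)%R, (series_one T); split.
  exists (series_one T) => m; rewrite /series_mul big_ord_recl subn0 /series_one mul1r.
  by rewrite big1 ?addr0 // => i _; rewrite mul0r.
move=> m; rewrite /series_mul big_ord_recr /= subnn mulr1 big1 ?add0r.
  by rewrite /series_of_poly coef_poly; case: ltnP => // /Hf.
by move=> i _; rewrite /series_one subn_eq0 leqNgt ltn_ord mulr0.
Qed.

Theorem theorem1p4 (T : comNzRingType) (k : nat) (t : 'I_k -> T)
    (t_generates : generates t) (T_infinite : infinite_type T) :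
  ~ exists D : tm, decides_poly_times_unit t D.
Proof.
case=> D HD.
have [qT Hq] := exists_counterexample t_generates T_infinite (erefl : ticks 1) ticks_gaps.
pose g n : T := if n == 0 then qT else (ticks n)%:R%R.
have [v0 Hv0] := encodes_exists 0%R t_generates.
have [v1 Hv1] := encodes_exists 1%R t_generates.
have [v2 Hv2] := encodes_exists qT t_generates.
have [M HM] := diagonal_machine D v0 v1 v2.
pose stopped n := says_false D (run D n (init (code_tm M))).
pose f n := if stopped n then 0%R else g n.
have Mf : computes_series t M f.
  move=> n; eexists; split; first exact: HM.
  rewrite -/(stopped n) /f /g -/(ticks n); case: ifP => // _.
  by case: ifP => // _; case: (ticks n).
have [b [Db Hb]] := HD M f Mf.
case: b Db Hb => Db [Hb Hb'].
  (* After the answer [true], no halting configuration of [D] reads [false], so no coefficient is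
     suppressed and [f] is the sparse series. *)
  apply: (Hq f) (Hb isT) => n; rewrite /f; case: ifP => // /says_false_outputs/(_ _ Db) //.
(* After the answer [false], all coefficients from some index on are suppressed, so [f] is a
   polynomial. *)
have [n Hn] := outputs_says_false Db.
have : false by apply: Hb'; apply: (@finite_poly_times_unit _ _ n) => m /Hn; rewrite /f /stopped => ->.
by [].
Qed.
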